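(* Fix $\beta\ge 0$, an integer $n\ge1$, $m\in\{1,\dots,n\}$ and $\alpha\in[2,2n+2)$. The following two statements are equivalent. (i) For every Borel set $A\subseteq\mathbb{H}^n$ with $\dim_{\mathbb{H}^n}A>\alpha$, $\dim_{\mathbb{V}\backslash\mathbb{H}^n}P^R_{\mathbb{V}^\perp}(A)\ge\beta$ for $\mu_{n,m}$-a.e. $V\in G_h(n,m)$. (ii) For every Borel set $A\subseteq\mathbb{H}^n$ with $\dim_{\mathbb{H}^n}A>\alpha$, $\dim_E P^R_{\mathbb{V}^\perp}(A)\ge\beta$ for $\mu_{n,m}$-a.e. $V\in G_h(n,m)$.
   Context: The Heisenberg group $\mathbb{H}^n$ is $\mathbb{R}^{2n}\times\mathbb{R}$, with points $(z,t)$, $z=(x_1,\dots,x_n,y_1,\dots,y_n)$, and group law $(z,t)*(w,s)=(z+w,\,t+s+\tfrac12\omega(z,w))$, where for $w=(u_1,\dots,u_n,v_1,\dots,v_n)$, $\omega(z,w)=\sum_{j=1}^n(x_jv_j-y_ju_j)$. Let $X_j=\partial_{x_j}-\tfrac{y_j}{2}\partial_t$, $Y_j=\partial_{y_j}+\tfrac{x_j}{2}\partial_t$ ($1\le j\le n$). The Carnot–Carathéodory metric $d_{cc}(p,q)$ is the infimum of $\int_0^1(\sum_j a_j^2+b_j^2)^{1/2}ds$ over absolutely continuous curves $\gamma:[0,1]\to\mathbb{H}^n$ from $p$ to $q$ with $\dot\gamma=\sum_j a_jX_j+b_jY_j$ a.e.; it is bi-Lipschitz equivalent to the Korányi metric $d_{\mathbb{H}^n}(p,q)=\|q^{-1}*p\|$,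 $\|(z,t)\|^4=|z|^4+16t^2$. $G_h(n,m)$ is the set of $m$-dimensional isotropic linear subspaces $V$ of $\mathbb{R}^{2n}\cong\mathbb{C}^n$ (i.e. $\omega$ vanishes on $V\times V$), and $\mu_{n,m}$ is the unique probability measure on $G_h(n,m)$ invariant under the unitary group $U(n)$. For $V\in G_h(n,m)$ put $\mathbb{V}=V\times\{0\}$, $\mathbb{V}^\perp=V^\perp\times\mathbb{R}$. Let $P_{\mathbb{V}}(z,t)=(\pi_V(z),0)$, where $\pi_V$ is Euclidean orthogonal projection onto $V$, and let $P^R_{\mathbb{V}^\perp}:\mathbb{H}^n\to\mathbb{V}^\perp$, $P^R_{\mathbb{V}^\perp}(p)=P_{\mathbb{V}}(p)^{-1}*p$. On $\mathbb{V}^\perp$ (identified with the space of right cosets $\mathbb{V}\backslash\mathbb{H}^n$ via $\mathbb{V}q\mapsto q$) the quotient metric is $d_{\mathbb{V}\backslash\mathbb{H}^n}(p,p')=\inf_{q\in\mathbb{V}}d_{cc}(q*p,p')$. The notations $\dim_E$, $\dim_{\mathbb{H}^n}$, $\dim_{\mathbb{V}\backslash\mathbb{H}^n}$ denote Hausdorff dimension with respect to the Euclidean metric, $d_{cc}$, and $d_{\mathbb{V}\backslash\mathbb{H}^n}$ respectively. *)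

(* Defs.v *)
From HB Require Import structures.
From mathcomp Require Import all_boot all_order all_algebra.
From mathcomp Require Import complex.
From mathcomp Require Import all_classical all_reals all_analysis.

Set Implicit Arguments.
Unset Strict Implicit.
Unset Printing Implicit Defensive.

Import Order.TTheory GRing.Theory Num.Theory.
Import numFieldNormedType.Exports.

Local Open Scope classical_set_scope.
Local Open Scope ring_scope.

Section Hausdorff.
Context {R : realType} {T : Type} (d : T -> T -> \bar R).
Local Open Scope ereal_scope.

Definition diam (U : set T) : \bar R := ereal_sup [set d x y | x in U & y in U].

(* The empty set has weight 0 for every [s], while a singleton has weight
   [0 `^ 0 = 1] for [s = 0]. *)
Definition diam_pow (s : R) (U : set T) : \bar R :=
  if `[< U = set0 >] then 0 else diam U `^ s.

Definition hausdorff_content (s delta : R) (A : set T) : \bar R :=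
  ereal_inf [set \sum_(0 <= i <oo) diam_pow s (U i) |
    U in [set U : (set T)^nat |
           A `<=` \bigcup_i U i /\ forall i, diam (U i) <= delta%:E]].

Definition hausdorff_measure (s : R) (A : set T) : \bar R :=
  ereal_sup [set hausdorff_content s delta A | delta in [set x : R | (0 < x)%R]].

(* Only the values of [d] on [A] matter, since the covering sets may be
   intersected with [A]; so [d] may be a metric on a subset containing [A]. *)
Definition hausdorff_dim (A : set T) : \bar R :=
  ereal_inf [set s%:E | s in [set s : R |
    (0 <= s)%R /\ hausdorff_measure s A = 0]].

End Hausdorff.

Definition heis (R : realType) (n : nat) : Type := ('rV[R]_(n + n) * R)%type.

Section Heisenberg.
Context {R : realType} {n : nat}.
Implicit Types (z w : 'rV[R]_(n + n)) (p q : heis R n).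

Definition xcoord z (j : 'I_n) : R := z 0 (lshift n j).
Definition ycoord z (j : 'I_n) : R := z 0 (rshift n j).

Definition omega z w : R :=
  \sum_(j < n) (xcoord z j * ycoord w j - ycoord z j * xcoord w j).

Definition hmul p q : heis R n := (p.1 + q.1, p.2 + q.2 + omega p.1 q.1 / 2).
Definition hinv p : heis R n := (- p.1, - p.2).

Definition Xfield (j : 'I_n) p : heis R n :=
  (delta_mx 0 (lshift n j), - (ycoord p.1 j / 2)).
Definition Yfield (j : 'I_n) p : heis R n :=
  (delta_mx 0 (rshift n j), xcoord p.1 j / 2).

Definition dotr z w : R := \sum_(i < n + n) z 0 i * w 0 i.

Definition euclid_dist p q : \bar R :=
  (Num.sqrt (dotr (p.1 - q.1) (p.1 - q.1) + (p.2 - q.2) ^+ 2))%:E.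

End Heisenberg.

Definition abs_continuous {R : realType} (a b : R) (f : R -> R) : Prop :=
  forall e : R, 0 < e -> exists2 delta : R, 0 < delta &
    forall (k : nat) (u v : 'I_k -> R),
      (forall i, [/\ a <= u i, u i <= v i & v i <= b]) ->
      (forall i j, i != j -> v i <= u j \/ v j <= u i) ->
      \sum_(i < k) (v i - u i) < delta ->
      \sum_(i < k) `|f (v i) - f (u i)| < e.

Section CarnotCaratheodory.
Context {R : realType} {n : nat}.
Implicit Types (p q : heis R n).

Definition abs_continuous_curve (gamma : R -> heis R n) : Prop :=
  (forall i, abs_continuous 0 1 (fun s => (gamma s).1 0 i)) /\
  abs_continuous 0 1 (fun s => (gamma s).2).

(* Values of [gamma] outside [0, 1] are irrelevant: the derivative condition is
   imposed almost everywhere on [0, 1], hence only matters on ]0, 1[. *)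
Definition horizontal (gamma : R -> heis R n) (a b : 'I_n -> R -> R) : Prop :=
  [/\ abs_continuous_curve gamma,
      (forall j, measurable_fun (`[0, 1] : set R) (a j)),
      (forall j, measurable_fun (`[0, 1] : set R) (b j)) &
      {ae (@lebesgue_measure R), forall s : R, s \in `[0%R, 1%R] ->
        is_derive s 1 gamma
          (\sum_(j < n) (a j s *: Xfield j (gamma s) +
                         b j s *: Yfield j (gamma s)))}].

Definition cc_length (a b : 'I_n -> R -> R) : \bar R :=
  (\int[@lebesgue_measure R]_(s in `[0%R, 1%R])
     (Num.sqrt (\sum_(j < n) (a j s ^+ 2 + b j s ^+ 2)))%:E)%E.

Definition cc_dist p q : \bar R :=
  ereal_inf [set L | exists gamma a b,
    [/\ horizontal gamma a b, gamma 0 = p, gamma 1 = q & L = cc_length a b]].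

End CarnotCaratheodory.

Section Projections.
Context {R : realType} {n : nat} (V : {vspace 'rV[R]_(n + n)}).

(* [xget] picks the unique [w] in [V] with [z - w] orthogonal to [V]. *)
Definition orth_proj (z : 'rV[R]_(n + n)) : 'rV[R]_(n + n) :=
  xget 0 [set w | w \in V /\ forall v, v \in V -> dotr (z - w) v = 0].

Definition hproj (p : heis R n) : heis R n := (orth_proj p.1, 0).

Definition hprojR (p : heis R n) : heis R n := hmul (hinv (hproj p)) p.

Definition quot_dist (p p' : heis R n) : \bar R :=
  ereal_inf [set cc_dist (hmul (v, 0) p) p' | v in [set v | v \in V]].

End Projections.

Definition isotropic {R : realType} {n : nat} (V : {vspace 'rV[R]_(n + n)}) :=
  forall u v, u \in V -> v \in V -> omega u v = 0.

(* The proof argument guarantees that the type is inhabited. *)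
Definition Gh (R : realType) (n m : nat) (h : (m <= n)%N) : Type :=
  {V : {vspace 'rV[R]_(n + n)} | (\dim V == m) && `[< isotropic V >]}.

Section GhInhabited.
Context {R : realType} {n m : nat} (h : (m <= n)%N).

Let B : 'M[R]_(m, n + n) := row_mx (pid_mx m) 0.
Let V0 : {vspace 'rV[R]_(n + n)} := limg (linfun (mulmxr B : 'rV_m -> 'rV_(n + n))).

Lemma Gh_inhabited : (\dim V0 == m) && `[< isotropic V0 >].
Proof.
apply/andP; split.
  rewrite /V0 limg_dim_eq; first by rewrite dimvf dim_matrix; apply/eqP/mul1n.
  suff /eqP -> : lker (linfun (mulmxr B : 'rV[R]_m -> 'rV_(n + n))) == 0%VS.
    by rewrite capv0.
  apply/lker0P => u v; rewrite !lfunE /= => /(congr1 (mulmxr (col_mx (pid_mx m) 0 : 'M[R]_(n + n, m)))).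
  by rewrite /= -!mulmxA mul_row_col mul0mx addr0 pid_mx_id // pid_mx_1 !mulmx1.
apply/asboolP => u v /memv_imgP[a _ ->] /memv_imgP[b _ ->].
rewrite !lfunE /= /omega big1 // => j _.
by rewrite /B !mul_mx_row !mulmx0 /xcoord /ycoord !row_mxEr !mxE mulr0 mul0r subr0.
Qed.

End GhInhabited.

Section GhStructures.
Context {R : realType} {n m : nat} (h : (m <= n)%N).

HB.instance Definition _ := Choice.copy (Gh R h)
  {V : {vspace 'rV[R]_(n + n)} | (\dim V == m) && `[< isotropic V >]}.
HB.instance Definition _ := isPointed.Build (Gh R h)
  (exist (fun V => (\dim V == m) && `[< isotropic V >]) _ (Gh_inhabited h)).

Definition Gh_val (V : Gh R h) : {vspace 'rV[R]_(n + n)} := sval V.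

(* The matrix of the orthogonal projection onto [V]. *)
Definition Gh_mx (V : Gh R h) : 'M[R]_(n + n) :=
  \matrix_(i, j) orth_proj (Gh_val V) (delta_mx 0 i) 0 j.

(* The topology induced by the metric [|pi_V - pi_W|]. *)
HB.instance Definition _ := Topological.copy (Gh R h) (initial_topology Gh_mx).

End GhStructures.

Notation borel T := (g_sigma_algebraType (@open T)).
Definition borel_set {T : topologicalType} : set (set T) := <<s @open T >>.

Section Unitary.
Context {R : realType} {n : nat}.

Definition to_C (z : 'rV[R]_(n + n)) : 'rV[R[i]]_n :=
  \row_j (xcoord z j +i* ycoord z j)%C.
Definition of_C (c : 'rV[R[i]]_n) : 'rV[R]_(n + n) :=
  row_mx (\row_j complex.Re (c 0 j)) (\row_j complex.Im (c 0 j)).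

(* Vectors are rows, so [c *m U^T] is the matrix [U] applied to [c]. *)
Definition unitary_act (U : 'M[R[i]]_n) (z : 'rV[R]_(n + n)) : 'rV[R]_(n + n) :=
  of_C (to_C z *m U^T).

Context {m : nat} {h : (m <= n)%N}.

Definition Gh_act (U : 'M[R[i]]_n) (S : set (Gh R h)) : set (Gh R h) :=
  [set W | exists2 V, S V &
    [set` Gh_val W] = unitary_act U @` [set` Gh_val V]].

(* This characterizes [mu_{n,m}]: [U(n)] acts transitively on [G_h(n,m)], so
   there is exactly one invariant probability measure. *)
Definition unitary_invariant (mu : probability (borel (Gh R h)) R) : Prop :=
  forall U : 'M[R[i]]_n, U \is unitarymx ->
  forall S : set (Gh R h), borel_set S ->
    mu (Gh_act U S) = mu S.

End Unitary.

(* Main.v *)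
(* The quotient metric dominates the Euclidean metric, up to constants, on bounded parts
   of V^\perp: a horizontal curve of length r moves each coordinate of z by at most r, so
   by orthogonality it joins V p to p' only if |z - z'| = O(r), and then its height changes
   by O(r). Hence dim_E <= dim_{V\H}, for every V.

   Conversely, near points where some v in V has omega(v, z) <> 0, translating by a
   multiple of v corrects heights at a linear cost, so the two metrics are comparable. The
   t-axis has dimension 2 <= alpha; so some p0 = (z0, t0) with z0 <> 0 has
   dim (A n B(p0, r)) > alpha for every r > 0. For almost every V, omega(., z0) does not
   vanish on V, and the hypothesis applied to the sets A n B(p0, 1/k) gives the bound. The
   exceptional V are null: transitivity of U(n) on spheres gives the annihilators of
   multiples of all moment vectors (1, k, ..., k^(2n-1)) the same measure, while a given V
   belongs to fewer than 2n of them. *)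
From HB Require Import structures.
Require Import Defs.
From mathcomp Require Import all_boot all_order all_algebra.
From mathcomp Require Import all_classical all_reals all_analysis.
From mathcomp Require Import measurable_realfun complex ring lra.

Set Implicit Arguments.
Unset Strict Implicit.
Unset Printing Implicit Defensive.

Import Order.TTheory GRing.Theory Num.Theory.
Import numFieldNormedType.Exports.

Local Open Scope classical_set_scope.
Local Open Scope ring_scope.


(** [mu] is known only through its invariance, so smallness of the exceptional set comes from
    counting: if infinitely many sets share the measure c and no V lies in more than 2n of them,
    integrating the number of memberships gives M c <= 2n for every M. The moment curve supplies
    such sets because omega(v, .) restricted to it is a polynomial. The radius on which the two
    metrics are comparable depends on V. Hence the hypothesis is applied to all radii 1/k before V
    is fixed, and a countable union of null sets is discarded. Lengths are integrals of merely
    measurable controls along absolutely continuous curves, so bounding a displacement by a length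
    rests on |f(x) - f(0)| <= int |f'| for absolutely continuous f. This is derived by comparing f
    with a monotone primitive. *)

(** * Null sets of Hausdorff measures and comparison of dimensions *)

Section HausdorffNull.
Context {R : realType} {T : Type}.
Implicit Types (d : T -> T -> \bar R) (A : set T).
Local Open Scope ereal_scope.

(** Vanishing of the Hausdorff measure, spelled out through covers. Dimensions only see the
    exponents at which the measure vanishes, so they can be compared through this predicate
    alone. *)
Definition hausdorff_null d (s : R) A := forall delta e : R,
  (0 < delta)%R -> (0 < e)%R -> exists U : (set T)^nat,
    [/\ A `<=` \bigcup_i U i, forall i, diam d (U i) <= delta%:E &
        \sum_(0 <= i <oo) diam_pow d s (U i) < e%:E].

Lemma diam_pow_ge0 d s U : 0 <= diam_pow d s U.
Proof. by rewrite /diam_pow; case: ifP => // _; exact: poweR_ge0. Qed.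

Lemma diam_pow0 d s : diam_pow d s set0 = 0.
Proof. by rewrite /diam_pow; case: asboolP. Qed.

Lemma diam_set0 d : diam d set0 = -oo.
Proof.
rewrite /diam (_ : [set _ | _ in _ & _ in _] = set0) ?ereal_sup0//.
by rewrite -subset0 => x [].
Qed.

Lemma diam_ge0 d U : (forall x y, 0 <= d x y) -> U !=set0 -> 0 <= diam d U.
Proof.
move=> d0 [x Ux]; apply: (le_trans (d0 x x)).
by apply: ereal_sup_ubound; exists x => //; exists x.
Qed.

Lemma diam_powE d s U : U !=set0 -> diam_pow d s U = diam d U `^ s.
Proof.
by rewrite /diam_pow; case: asboolP => // -> [].
Qed.

Lemma hausdorff_measure0P d s A :
  hausdorff_measure d s A = 0 <-> hausdorff_null d s A.
Proof.
have content_ge0 delta : 0 <= hausdorff_content d s delta A.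
  apply: le_ereal_inf_tmp => _ [U _ <-].
  by apply: nneseries_ge0 => i _ _; exact: diam_pow_ge0.
split=> [H delta e d0 e0|H].
  have : hausdorff_content d s delta A < e%:E.
    apply: (@le_lt_trans _ _ 0); last by rewrite lte_fin.
    by rewrite -H; apply: ereal_sup_ubound; exists delta.
  move=> /ereal_inf_lt[_ [U [AU Ud] <-] Ue].
  by exists U.
apply/eqP; rewrite eq_le; apply/andP; split.
  apply: ge_ereal_sup => _ [delta /= d0 <-].
  apply/lee_addgt0Pr => e e0; rewrite add0e.
  have [U [AU Ud Ue]] := H _ _ d0 e0.
  by apply: le_trans (ltW Ue); apply: ereal_inf_lbound; exists U.
apply: le_trans (content_ge0 1%R) _.
by apply: ereal_sup_ubound; exists 1%R => //=.
Qed.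

Lemma sub_hausdorff_null d s A B : A `<=` B ->
  hausdorff_null d s B -> hausdorff_null d s A.
Proof.
move=> AB H delta e d0 e0; have [U [BU Ud Ue]] := H _ _ d0 e0.
by exists U; split => //; exact: subset_trans BU.
Qed.

Lemma hausdorff_null_bigcup d s (A : (set T)^nat) :
  (forall i, hausdorff_null d s (A i)) -> hausdorff_null d s (\bigcup_i A i).
Proof.
move=> H delta e d0 e0.
(* The budgets of the pieces add up to e / 2, which keeps the final inequality strict. *)
have e20 : (0 < e / 2)%R by rewrite divr_gt0.
have : forall i, exists U : (set T)^nat,
    [/\ A i `<=` \bigcup_i U i, forall i, diam d (U i) <= delta%:E &
        \sum_(0 <= k <oo) diam_pow d s (U k) < ((e / 2) / (2 ^ i.+1)%:R)%:E].
  by move=> i; apply: H => //; rewrite divr_gt0.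
move=> /choice[G HG].
have a_ge0 x : 0 <= (diam_pow d s \o uncurry G) x by exact: diam_pow_ge0.
have /card_esym/ppcard_eqP[f] := card_nat2.
exists (uncurry G \o f); split.
- move=> x [i _ Aix]; have [+ _ _] := HG i => /(_ _ Aix)[j _ Gij].
  by exists (f^-1%FUN (i, j)) => //=; rewrite invK ?inE.
- by move=> i /=; case: (f i) => j k /=; have [_ + _] := HG j.
rewrite nneseries_esumT; last by move=> i; exact: diam_pow_ge0.
rewrite -(@reindex_esum _ _ _ setT setT f (diam_pow d s \o uncurry G)); last first.
  exact: bij.
have -> : [set: nat * nat] = [set: nat] `*`` (fun=> setT).
  by apply/seteqP; split.
rewrite [X in X < _](_ : _ = \esum_(k in [set: nat] `*`` (fun=> setT))
    diam_pow d s (G k.1 k.2)); last by apply: eq_esum => -[].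
rewrite -(@esum_esum _ _ _ setT (fun=> setT) (fun i j => diam_pow d s (G i j)))//; last first.
  by move=> *; exact: diam_pow_ge0.
rewrite -nneseries_esumT; last by move=> i; apply: esum_ge0 => *; exact: diam_pow_ge0.
apply: (@le_lt_trans _ _ (\sum_(i <oo) (0 + ((e / 2) / (2 ^ i.+1)%:R)%:E))).
  apply: lee_nneseries => i _.
    by move=> _; apply: esum_ge0 => *; exact: diam_pow_ge0.
  rewrite add0e -nneseries_esumT; last by move=> *; exact: diam_pow_ge0.
  by have [_ _ /ltW] := HG i.
apply: le_lt_trans (epsilon_trick _ (fun=> lexx _) (ltW e20)) _.
by rewrite eseries0// add0e lte_fin ltr_pdivrMr// ltr_pMr// ltr1n.
Qed.

(* The weight of a nonempty set of diameter at most 1 decreases with [s], even for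
   diameter 0, where the weight jumps from 1 to 0 as [s] leaves 0. *)
Lemma hausdorff_null_le d s s' A : (forall x y, 0 <= d x y) -> (0 <= s <= s')%R ->
  hausdorff_null d s A -> hausdorff_null d s' A.
Proof.
move=> d_ge0 /andP[s0 ss'] H delta e d0 e0.
have d10 : (0 < Order.min delta 1)%R by rewrite lt_min d0 ltr01.
have [U [AU Ud Ue]] := H _ _ d10 e0.
exists U; split => //.
  by move=> i; apply: le_trans (Ud i) _; rewrite lee_fin ge_min lexx.
apply: le_lt_trans Ue; apply: lee_nneseries => [*|i _]; first exact: diam_pow_ge0.
have [->|/set0P U0] := eqVneq (U i) set0; first by rewrite !diam_pow0.
rewrite !diam_powE//.
have := Ud i; have := diam_ge0 d_ge0 U0; case: (diam d (U i)) => [r||]//.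
rewrite !poweR_EFin !lee_fin le_min => r0 /andP[_ r1].
have [->|rn0] := eqVneq r 0%R.
  have [s'0|s'0] := eqVneq s' 0%R; last by rewrite powR0// powR_ge0.
  have -> : s = 0%R by apply/eqP; rewrite eq_le s0 andbT -s'0.
  by rewrite s'0.
by apply: ger_powR => //; rewrite lt_neqAle eq_sym rn0 r0.
Qed.

Lemma hausdorff_null_lipschitz d d' s (C : R) A :
  (forall x y, 0 <= d x y) -> (forall x y, 0 <= d' x y) -> (0 <= s)%R -> (0 < C)%R ->
  {in A &, forall x y, d' x y <= C%:E * d x y} ->
  hausdorff_null d s A -> hausdorff_null d' s A.
Proof.
move=> d_ge0 d'_ge0 s0 C0 dC H delta e d0 e0.
have Cs0 : (0 < C `^ s)%R by rewrite powR_gt0.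
have [U [AU Ud Ue]] := H (delta / C)%R (e / C `^ s)%R (divr_gt0 d0 C0) (divr_gt0 e0 Cs0).
have dU i : A `&` U i !=set0 -> diam d' (A `&` U i) <= C%:E * diam d (U i).
  move=> U0; apply: ge_ereal_sup => _ [x [Ax Ux] [y [Ay Uy] <-]].
  apply: le_trans (dC _ _ (mem_set Ax) (mem_set Ay)) _.
  rewrite lee_wpmul2l//; first by rewrite lee_fin ltW.
  by apply: ereal_sup_ubound; exists x => //; exists y.
(* The Lipschitz bound holds on [A] only, so the covering sets are cut down to [A]. *)
exists (fun i => A `&` U i); split.
- by move=> x Ax; have [i _ Uix] := AU _ Ax; exists i.
- move=> i; have [->|/set0P U0] := eqVneq (A `&` U i) set0; first by rewrite diam_set0 leNye.
  by apply: le_trans (dU _ U0) _; rewrite -lee_pdivlMl// -EFinM mulrC.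
have -> : e%:E = (C `^ s)%:E * (e / C `^ s)%:E.
  by rewrite -EFinM mulrCA divff ?mulr1// gt_eqF.
apply: (@le_lt_trans _ _ ((C `^ s)%:E * \sum_(0 <= i <oo) diam_pow d s (U i))); last first.
  by rewrite lte_pmul2l.
rewrite -nneseriesZl => [|i _]; last exact: diam_pow_ge0.
apply: lee_nneseries => [i _ _|i _ /=]; first exact: diam_pow_ge0.
have [->|/set0P U0] := eqVneq (A `&` U i) set0.
  by rewrite diam_pow0 mule_ge0 ?diam_pow_ge0// lee_fin ltW.
have Ui0 : U i !=set0 by case: U0 => x [_ Ux]; exists x.
have C0' : 0 <= C%:E by rewrite lee_fin ltW.
have dUi0 : 0 <= diam d (U i) by exact: diam_ge0.
rewrite !diam_powE// -poweR_EFin -poweRM//; apply: gt0_ler_poweR => //.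
- by rewrite in_itv/= leey andbT diam_ge0.
- by rewrite in_itv/= leey andbT mule_ge0.
- exact: dU.
Qed.

Lemma hausdorff_dim_le d s A : (0 <= s)%R -> hausdorff_null d s A ->
  hausdorff_dim d A <= s%:E.
Proof.
move=> s0 H; apply: ereal_inf_lbound; exists s => //; split => //.
exact/hausdorff_measure0P.
Qed.

Lemma hausdorff_null_gt_dim d s A : (forall x y, 0 <= d x y) ->
  hausdorff_dim d A < s%:E -> hausdorff_null d s A.
Proof.
move=> d_ge0 /ereal_inf_lt[_ [r [r0 /hausdorff_measure0P H] <-]].
by rewrite lte_fin => /ltW rs; apply: hausdorff_null_le H; rewrite ?r0.
Qed.

Lemma le_hausdorff_dim d d' A B :
  (forall s, (0 <= s)%R -> hausdorff_null d s B -> hausdorff_null d' s A) ->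
  hausdorff_dim d' A <= hausdorff_dim d B.
Proof.
move=> H; apply: le_ereal_inf_tmp => _ [s [s0 /hausdorff_measure0P Bs] <-].
by apply: hausdorff_dim_le => //; exact: H.
Qed.

Lemma hausdorff_dim_bigcup_le d (a : R) (A : (set T)^nat) :
  (forall x y, 0 <= d x y) -> (0 <= a)%R ->
  (forall i, hausdorff_dim d (A i) <= a%:E) -> hausdorff_dim d (\bigcup_i A i) <= a%:E.
Proof.
move=> d_ge0 a0 H; apply/lee_addgt0Pr => e e0.
rewrite -EFinD; apply: hausdorff_dim_le; first by rewrite addr_ge0// ltW.
apply: hausdorff_null_bigcup => i; apply: hausdorff_null_gt_dim => //.
by apply: le_lt_trans (H i) _; rewrite lte_fin ltrDl.
Qed.

End HausdorffNull.


(** * Comparison of an absolutely continuous function with a monotone one *)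

Section AbsolutelyContinuous.
Context {R : realType}.
Implicit Types (a b x y : R) (f F : R -> R).
Local Notation mu := (@lebesgue_measure R).

(** Continuous induction on the right endpoint. Additivity of [P] stands in for a tagged partition,
    so Cousin's covering argument runs without building one. *)
Lemma cousin_ind (P : R -> R -> Prop) a b : a <= b ->
  (forall x y z, a <= x -> x <= y -> y <= z -> z <= b -> P x y -> P y z -> P x z) ->
  (forall c, a <= c <= b -> exists2 rho, 0 < rho & forall x y,
    a <= x -> c - rho < x -> x <= c -> c <= y -> y < c + rho -> y <= b -> P x y) ->
  P a b.
Proof.
move=> ab Ptrans Ploc.
pose S := [set x | a <= x <= b /\ P a x].
have Sa : S a.
  split; first by rewrite lexx ab.
  have [|rho r0 H] := Ploc a; first by rewrite lexx.
  by apply: H => //; lra.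
have supS : has_sup S.
  by split; [exists a | exists b => x [/andP[]]].
have aS : a <= sup S by exact: sup_upper_bound.
have Sb : sup S <= b by apply: ge_sup; [exists a | move=> x [/andP[]]].
have [|rho r0 H] := Ploc (sup S); first by rewrite aS Sb.
have [x [/andP[ax xb] Pax] xS] := sup_adherent r0 supS.
have xleS : x <= sup S by apply: sup_upper_bound => //; split => //; rewrite ax xb.
pose y := Order.min (sup S + rho / 2) b.
have Sy : sup S <= y by rewrite le_min Sb andbT; lra.
have yb : y <= b by rewrite ge_min lexx orbT.
have Pay : P a y.
  apply: (Ptrans _ x) => //; first exact: le_trans Sy.
  apply: H => //; apply: (@le_lt_trans _ _ (sup S + rho / 2)); last lra.
  by rewrite ge_min lexx.
have : y <= sup S.
  by apply: sup_upper_bound => //; split => //; rewrite (le_trans aS Sy) yb.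
rewrite ge_min => /orP[|bS]; first lra.
suff -> : b = y by [].
by apply/eqP; rewrite eq_le yb andbT (le_trans bS).
Qed.

Lemma is_derive_approx f x df e : is_derive x (1 : R) f df -> 0 < e ->
  exists2 rho, 0 < rho & forall y, `|y - x| < rho ->
    `|f y - f x - df * (y - x)| <= e * `|y - x|.
Proof.
move=> [dfx <-] e0; move: dfx => /cvg_ex[l Hl].
have <- : l = 'D_1 f x by apply/esym/cvg_lim.
move/cvgrPdist_le : Hl => /(_ _ e0)/nbhs_ballP[rho /= r0 H].
exists rho => // y yx; have [->|ynx] := eqVneq y x.
  by rewrite !subrr mulr0 subr0 normr0 mulr0.
have yx0 : y - x != 0 by rewrite subr_eq0.
have := H (y - x); rewrite /ball/= sub0r normrN => /(_ yx yx0).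
rewrite [_ *: 1]mulr1 subrK => Hl.
rewrite -(ler_pM2r (_ : 0 < `|y - x|^-1)) ?invr_gt0 ?normr_gt0//.
rewrite mulfK ?normr_eq0// -normfV [`|_ - _ * _|]distrC -normrM.
rewrite (_ : _ * _ = l - (y - x)^-1 *: (f y - f x))//.
by rewrite [_ *: _]mulrC mulrBl mulfK.
Qed.

(** Ordered lists, unlike the indexed families of [abs_continuous], can be concatenated when
    adjacent intervals are glued. *)
Definition interval_seq x y (s : seq (R * R)) :=
  all (fun p => (x <= p.1) && (p.1 <= p.2) && (p.2 <= y)) s /\
  pairwise (fun p q : R * R => p.2 <= q.1) s.

Lemma interval_seq_cat x y z s t : x <= y -> y <= z ->
  interval_seq x y s -> interval_seq y z t -> interval_seq x z (s ++ t).
Proof.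
move=> xy yz [/allP As Ps] [/allP At Pt]; split.
  rewrite all_cat; apply/andP; split; apply/allP => p.
    by move=> /As /andP[/andP[-> ->]] /le_trans ->.
  by move=> /At /andP[/andP[yp ->] ->]; rewrite (le_trans xy yp).
rewrite pairwise_cat Ps Pt !andbT; apply/allrelP => p q /As /andP[_ py].
by move=> /At /andP[/andP[/(le_trans py)]].
Qed.

Lemma abs_continuous_seq a b f e : abs_continuous a b f -> 0 < e ->
  exists2 delta : R, 0 < delta & forall s, interval_seq a b s ->
    \sum_(p <- s) (p.2 - p.1) < delta -> \sum_(p <- s) `|f p.2 - f p.1| < e.
Proof.
move=> fac e0; have [delta d0 H] := fac _ e0; exists delta => // s [/allP As Ps].
rewrite !(big_nth (0, 0)) !big_mkord => sd.
apply: (H _ (fun i => (nth (0, 0) s i).1) (fun i => (nth (0, 0) s i).2)) => //.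
  by move=> i; have /As/andP[/andP[]] := mem_nth (0, 0) (ltn_ord i).
move=> i j; move/(pairwiseP (0, 0)) : Ps => Ps; rewrite neq_ltn => /orP[] ij.
- by left; apply: Ps => //; rewrite inE.
- by right; apply: Ps => //; rewrite inE.
Qed.

(* Cousin's argument: away from the exceptional null set the derivatives control
   the increments; tagged intervals meeting the null set lie in an open set of small
   measure, where absolute continuity makes the variation of [f] small. *)
Lemma abs_continuous_le a b f F : a <= b -> abs_continuous a b f ->
  {homo F : x y / x <= y} ->
  {ae mu, forall x, a <= x <= b -> exists df dF : R,
    [/\ is_derive x (1 : R) f df, is_derive x (1 : R) F dF & df <= dF]} ->
  f b - f a <= F b - F a.
Proof.
move=> ab fac Fmono [N [mN N0 HN]].
apply/ler_addgt0Pr => e e0.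
have HN' x : ~ N x -> a <= x <= b -> exists df dF : R,
    [/\ is_derive x (1 : R) f df, is_derive x (1 : R) F dF & df <= dF].
  by move=> Nx; apply: contrapT => H; apply: Nx; exact: HN.
(* Half of e pays for the derivative errors, at most e1 (b - a) in total, and half for the variation
   of f over intervals tagged in [N]. The summand 1 keeps the denominator positive when a = b. *)
pose e1 := e / 2 / (b - a + 1).
have ba1 : 0 < b - a + 1 by lra.
have e10 : 0 < e1 by rewrite !divr_gt0.
have e20 : 0 < e / 2 by rewrite divr_gt0.
have [delta d0 Hd] := abs_continuous_seq fac e20.
have [|G [oG NG]] := lebesgue_regularity_outer mN _ d0; first by rewrite [X in (X < _)%E]N0 ltry.
move=> GNd.
have mG : measurable G by exact: open_measurable.
have Gd : (mu G < delta%:E)%E.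
  apply: le_lt_trans GNd; rewrite -(setDUK NG) measureU//=.
  - by rewrite N0 add0e (setDUK NG).
  - exact: measurableD.
  - by rewrite setIC setDKI.
have mGi x y : measurable (G `&` `]x, y]) by apply: measurableI.
(* The list s collects the intervals tagged in [N]; its length is charged to the part of [G] in a
   half-open interval, so that the charges of adjacent intervals add up. *)
pose P x y := exists s, [/\ interval_seq x y s,
  ((\sum_(p <- s) (p.2 - p.1))%:E <= mu (G `&` `]x, y]))%E &
  f y - f x <= F y - F x + e1 * (y - x) + \sum_(p <- s) `|f p.2 - f p.1|].
have : P a b.
  apply: cousin_ind => // [x y z ax xy yz zb [s [sxy slen sf]] [t [tyz tlen tf]]|c acb].
    exists (s ++ t); split; first exact: interval_seq_cat tyz.
      rewrite big_cat/= EFinD; apply: (le_trans (leeD slen tlen)).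
      rewrite -measureU; first by rewrite -setIUr -itv_bndbnd_setU.
      - exact: mGi.
      - exact: mGi.
rewrite setIACA setIid -subset0 => r [_ []]/=; rewrite !in_itv/=.
      by move=> /andP[_ ry] /andP[]; rewrite ltNge ry.
    by rewrite big_cat/=; lra.
  have [cN|cN] := pselect (N c).
    have /nbhs_ballP[rho /= r0 rG] : nbhs c G by apply: open_nbhs_nbhs; split => //; exact: NG.
    exists rho => // x y ax cx xc cy yc yb.
    have xy : x <= y by exact: le_trans cy.
    exists [:: (x, y)]; split.
    - by split => //=; rewrite xy !lexx.
    - rewrite big_seq1/= (_ : G `&` _ = `]x, y]%classic).
        by rewrite lebesgue_measure_itv/= lte_fin; case: ltP => //; rewrite lee_fin subr_le0.
      apply: setIidr => r/=; rewrite in_itv/= => /andP[xr ry]; apply: rG.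
      by rewrite /ball/= ltr_norml; apply/andP; split; lra.
    - rewrite big_seq1/=; have := ler_norm (f y - f x); have := Fmono _ _ xy.
      have : 0 <= e1 * (y - x) by apply: mulr_ge0; lra.
      lra.
  have /HN' := cN => /(_ acb)[df [dF [fdf FdF dfF]]].
  have e120 : 0 < e1 / 2 by rewrite divr_gt0.
  have [r1 r10 H1] := is_derive_approx fdf e120.
  have [r2 r20 H2] := is_derive_approx FdF e120.
  exists (Order.min r1 r2); first by rewrite lt_min r10.
  move=> x y ax cx xc cy yc yb; exists [::]; split => //.
    by rewrite big_nil measure_ge0.
  rewrite big_nil addr0.
  have mr1 : Order.min r1 r2 <= r1 by rewrite ge_min lexx.
  have mr2 : Order.min r1 r2 <= r2 by rewrite ge_min lexx orbT.
  have xcr : `|x - c| = c - x by rewrite ler0_norm; lra.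
  have ycr : `|y - c| = y - c by rewrite ger0_norm; lra.
  have := H1 x; have := H1 y; have := H2 x; have := H2 y; rewrite xcr ycr.
  move=> /(_ ltac:(lra)) /ler_normlP[A1 A2] /(_ ltac:(lra)) /ler_normlP[B1 B2].
  move=> /(_ ltac:(lra)) /ler_normlP[C1 C2] /(_ ltac:(lra)) /ler_normlP[D1 D2].
  have : 0 <= (dF - df) * (y - x) by rewrite mulr_ge0 ?subr_ge0 ?(le_trans xc).
  lra.
move=> [s [sab slen sf]].
have : \sum_(p <- s) `|f p.2 - f p.1| < e / 2.
  apply: Hd => //; rewrite -lte_fin; apply: le_lt_trans Gd.
  apply: le_trans slen _; apply: le_measure; rewrite ?inE; [exact: mGi|exact: mG|exact: subIsetl].
have : e1 * (b - a) <= e / 2.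
  by rewrite /e1 mulrAC ler_pdivrMr// ler_pM2l//; lra.
lra.
Qed.
End AbsolutelyContinuous.


(** * Increments of absolutely continuous functions bounded by integrals *)

Section AbsolutelyContinuousIntegral.
Context {R : realType}.
Implicit Types (a b x y : R) (f h : R -> R).
Local Notation mu := (@lebesgue_measure R).

Lemma abs_continuousN a b f : abs_continuous a b f -> abs_continuous a b (- f).
Proof.
move=> fac e e0; have [delta d0 H] := fac _ e0; exists delta => // k u v uv duv suv.
rewrite (eq_bigr (fun i => `|f (v i) - f (u i)|)) ?H// => i _.
by rewrite /= -opprD normrN.
Qed.

Lemma abs_continuousW a b c f : c <= b -> abs_continuous a b f -> abs_continuous a c f.
Proof.
move=> cb fac e e0; have [delta d0 H] := fac _ e0; exists delta => // k u v uv.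
by apply: H => i; have [? ? vc] := uv i; split => //; exact: le_trans cb.
Qed.

(** The monotone comparison function is the primitive [F] of C h, differentiable almost everywhere
    with derivative C h; comparing both f and -f with it controls the absolute value. *)
Lemma abs_continuous_le_integral f h (C x : R) : abs_continuous 0 1 f ->
  (forall s, 0 <= h s) -> measurable_fun (`[0, 1] : set R) h -> 0 < C -> 0 <= x <= 1 ->
  {ae mu, forall s : R, s \in `[0%R, 1%R] -> exists2 df : R,
    is_derive s (1 : R) f df & `|df| <= C * h s} ->
  (`|f x - f 0|%:E <= C%:E * \int[mu]_(s in `[0%R, 1%R]) (h s)%:E)%E.
Proof.
move=> fac h0 mh C0 /andP[x0 x1] Hae.
have mA : measurable (`[0%R, 1%R] : set R) by exact: measurable_itv.
have I0 : (0 <= \int[mu]_(s in `[0%R, 1%R]) (h s)%:E)%E.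
  by apply: integral_ge0 => s _; rewrite lee_fin.
have [Ioo|Ioo] := eqVneq (\int[mu]_(s in `[0%R, 1%R]) (h s)%:E)%E +oo%E.
  by rewrite Ioo mulry gtr0_sg// mul1e leey.
have ih : mu.-integrable `[0%R, 1%R] (EFin \o h).
  apply/integrableP; split; first exact/measurable_EFinP.
  under eq_integral do rewrite /= ger0_norm//.
  by rewrite ltey.
(* Extension by 0 makes the primitive start at minus infinity, as the differentiation theorem used
   below requires. *)
pose g := h \_ `[0%R, 1%R].
have g0 s : 0 <= g s by rewrite /g patchE; case: ifP.
have ig : mu.-integrable setT (EFin \o g).
  by rewrite /g -restrict_EFin -integrable_mkcond.
have gh : (\int[mu]_s (g s)%:E = \int[mu]_(s in `[0%R, 1%R]) (h s)%:E)%E.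
  rewrite [RHS]integral_mkcond; apply: eq_integral => s _.
  by rewrite restrict_EFin.
have igA (A : set R) : measurable A -> mu.-integrable A (EFin \o g).
  by move=> mB; apply: integrableS ig.
pose F s := C * (\int[mu]_(t in `]-oo, s]) g t).
have Fmono : {homo F : s t / s <= t}.
  move=> s t st; rewrite ler_pM2l// /Rintegral fine_le//.
  - by apply: integrable_fin_num => //; exact: igA.
  - by apply: integrable_fin_num => //; exact: igA.
  apply: ge0_subset_integral => //=.
  - by apply: measurable_int; exact: (igA _ _).
  - by move=> ? _; rewrite lee_fin.
  by apply: subset_itvl; rewrite bnd_simp.
have F0 : 0 <= F 0 by apply: mulr_ge0; [exact: ltW|apply: Rintegral_ge0].
have Fx : ((F x)%:E <= C%:E * \int[mu]_(s in `[0%R, 1%R]) (h s)%:E)%E.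
  rewrite -gh EFinM lee_pmul2l// ?lte_fin//.
  rewrite /Rintegral fineK; last by apply: integrable_fin_num => //; exact: igA.
  apply: ge0_subset_integral => //=.
  - by apply: measurable_int; exact: ig.
  - by move=> ? _; rewrite lee_fin.
have Fder : {ae mu, forall s : R, s \in `[0%R, 1%R] -> is_derive s (1 : R) F (C * h s)}.
  have := FTC1Ny (fun y => igA _ (measurable_itv _)) (integrable_locally mA ih).
  apply: filterS; first exact: (ae_filter_ringOfSetsType mu).
  move=> s [dG Gs] s01.
  have -> : C * h s = C *: g s by rewrite /g patchE mem_set.
  rewrite -Gs derive1E; apply: is_deriveZ.
  exact: derivableP.
have key f' : abs_continuous 0 1 f' ->
    {ae mu, forall s : R, s \in `[0%R, 1%R] -> exists2 df : R,
    is_derive s (1 : R) f' df & df <= C * h s} -> f' x - f' 0 <= F x - F 0.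
  move=> f'ac f'ae; apply: abs_continuous_le => //; first exact: abs_continuousW f'ac.
  apply: filterS2 f'ae Fder; first exact: (ae_filter_ringOfSetsType mu).
  move=> s Hs Fs /andP[s0 sx].
  have s01 : s \in `[0%R, 1%R] by rewrite in_itv/= s0 (le_trans sx).
  have [df fdf dfh] := Hs s01.
  by exists df, (C * h s); split => //; exact: Fs.
apply: le_trans Fx; rewrite lee_fin; apply: (@le_trans _ _ (F x - F 0)); last lra.
rewrite ler_norml; apply/andP; split.
  rewrite lerNl (_ : - _ = (- f) x - (- f) 0); last by rewrite /= opprD opprK.
  apply: key; first exact: abs_continuousN.
  apply: filterS Hae; first exact: (ae_filter_ringOfSetsType mu).
  move=> s /[apply] -[df fdf dfh]; exists (- df).
    exact: is_deriveN.
  by apply: le_trans dfh; rewrite -normrN ler_norm.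
apply: key => //.
apply: filterS Hae; first exact: (ae_filter_ringOfSetsType mu).
by move=> s /[apply] -[df fdf dfh]; exists df => //; apply: le_trans dfh; rewrite ler_norm.
Qed.

End AbsolutelyContinuousIntegral.

(** * Displacements along horizontal curves are bounded by length *)

Section LowerBounds.
Context {R : realType} {n : nat}.
Implicit Types (p q : heis R n) (gamma : R -> heis R n).
Local Notation mu := (@lebesgue_measure R).

Lemma is_derive_linear {V W : normedModType R} (L : V -> W) (g : R -> V) (s : R) (dg : V) :
  continuous L -> {morph L : x y / x - y} -> (forall k, {morph L : x / k *: x}) ->
  is_derive s (1 : R) g dg -> is_derive s (1 : R) (L \o g) (L dg).
Proof.
move=> Lcont LB LZ [gd <-].
have H : (h^-1 *:
    (((L \o g) \o shift s) (h *: (1 : R)) - (L \o g) s)) @[h --> 0^'] --> L ('D_1 g s).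
  rewrite (_ : (fun h => _) = L \o (fun h : R => h^-1 *: ((g \o shift s) (h *: (1 : R)) - g s))).
    exact: continuous_cvg (Lcont _) gd.
  by apply/funext => h /=; rewrite LZ LB.
by apply: DeriveDef; [apply/cvg_ex; eexists; exact: H | exact: cvg_lim H].
Qed.

Lemma is_derive_coord gamma (s : R) (v : heis R n) i : is_derive s (1 : R) gamma v ->
  is_derive s (1 : R) (fun s => (gamma s).1 0 i) (v.1 0 i).
Proof.
apply: (@is_derive_linear _ R^o (fun p : heis R n => p.1 0 i)) => [p|p q|k p] /=; last 2 first.
- by rewrite !mxE.
- by rewrite !mxE.
apply: (@continuous_comp _ _ _ fst (fun N : 'rV[R]_(n + n) => N 0 i)).
  exact: cvg_fst.
exact: coord_continuous.
Qed.

Lemma is_derive_height gamma (s : R) (v : heis R n) : is_derive s (1 : R) gamma v ->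
  is_derive s (1 : R) (fun s => (gamma s).2) v.2.
Proof.
apply: (@is_derive_linear _ R^o (fun p : heis R n => p.2)) => [p|p q|k p] //=.
exact: cvg_snd.
Qed.

Definition speed (a b : 'I_n -> R -> R) (s : R) :=
  Num.sqrt (\sum_(j < n) (a j s ^+ 2 + b j s ^+ 2)).

Lemma speed_ge0 a b s : 0 <= speed a b s.
Proof. exact: sqrtr_ge0. Qed.

Lemma sum_sqr_ge0 (a b : 'I_n -> R -> R) s : 0 <= \sum_(j < n) (a j s ^+ 2 + b j s ^+ 2).
Proof. by apply: sumr_ge0 => j _; rewrite addr_ge0 ?sqr_ge0. Qed.

Lemma speed_gea (a b : 'I_n -> R -> R) s j : `|a j s| <= speed a b s.
Proof.
rewrite -sqrtr_sqr ler_sqrt ?sum_sqr_ge0// (bigD1 j)//= -addrA lerDl.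
by rewrite addr_ge0 ?sqr_ge0// sumr_ge0// => k _; rewrite addr_ge0 ?sqr_ge0.
Qed.

Lemma speed_geb (a b : 'I_n -> R -> R) s j : `|b j s| <= speed a b s.
Proof.
rewrite -sqrtr_sqr ler_sqrt ?sum_sqr_ge0// (bigD1 j)//= addrAC lerDr.
by rewrite addr_ge0 ?sqr_ge0// sumr_ge0// => k _; rewrite addr_ge0 ?sqr_ge0.
Qed.

Lemma measurable_speed (D : set R) a b : measurable D ->
  (forall j, measurable_fun D (a j)) -> (forall j, measurable_fun D (b j)) ->
  measurable_fun D (speed a b).
Proof.
move=> mD ma mb; apply: (@measurableT_comp _ _ _ _ _ _ (@Num.sqrt R)).
  apply: continuous_measurable_fun; exact: sqrt_continuous.
by apply: measurable_sum => j; apply: measurable_funD; exact: measurable_funX.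
Qed.

Definition horizontal_velocity (a b : 'I_n -> R -> R) p s : heis R n :=
  \sum_(j < n) (a j s *: Xfield j p + b j s *: Yfield j p).

Lemma horizontal_velocity_x a b p s j :
  (horizontal_velocity a b p s).1 0 (lshift n j) = a j s.
Proof.
rewrite /horizontal_velocity raddf_sum summxE (bigD1 j)//= big1 => [|k kj].
  by rewrite !mxE !eqxx/= eq_lrshift mulr0 mulr1 !addr0.
by rewrite !mxE !eqxx/= eq_lrshift eq_lshift eq_sym (negbTE kj) !mulr0 addr0.
Qed.

Lemma horizontal_velocity_y a b p s j :
  (horizontal_velocity a b p s).1 0 (rshift n j) = b j s.
Proof.
rewrite /horizontal_velocity raddf_sum summxE (bigD1 j)//= big1 => [|k kj].
  by rewrite !mxE !eqxx/= eq_rlshift mulr0 mulr1 add0r addr0.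
by rewrite !mxE !eqxx/= eq_rlshift eq_rshift eq_sym (negbTE kj) !mulr0 addr0.
Qed.

Lemma horizontal_velocity_t a b p s : (horizontal_velocity a b p s).2 =
  \sum_(j < n) (b j s * (xcoord p.1 j / 2) - a j s * (ycoord p.1 j / 2)).
Proof.
rewrite /horizontal_velocity raddf_sum; apply: eq_bigr => j _ /=.
by rewrite [_ *: _]mulrN addrC.
Qed.

Lemma horizontal_coord_bound gamma a b (x : R) i : horizontal gamma a b -> 0 <= x <= 1 ->
  (`|(gamma x).1 0 i - (gamma 0).1 0 i|%:E <= cc_length a b)%E.
Proof.
move=> [[gac _] ma mb Hae] x01.
have mA : measurable (`[0%R, 1%R] : set R) by exact: measurable_itv.
have := @abs_continuous_le_integral R (fun s => (gamma s).1 0 i) (speed a b) 1 x (gac i)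
  (speed_ge0 a b) (measurable_speed mA ma mb) ltr01 x01.
rewrite mul1e; apply; apply: filterS Hae; first exact: (ae_filter_ringOfSetsType mu).
move=> s /[apply] /is_derive_coord - /(_ i); rewrite -/(horizontal_velocity _ _ _ _) => ds.
exists ((horizontal_velocity a b (gamma s) s).1 0 i) => //; rewrite mul1r.
case: (split_ordP i) => j ->.
  by rewrite horizontal_velocity_x speed_gea.
by rewrite horizontal_velocity_y speed_geb.
Qed.

Lemma horizontal_height_bound gamma a b (M : R) : horizontal gamma a b -> 0 < M ->
  (forall i (x : R), 0 <= x <= 1 -> `|(gamma x).1 0 i| <= M) ->
  (`|(gamma 1).2 - (gamma 0).2|%:E <= (n.+1%:R * M)%:E * cc_length a b)%E.
Proof.
move=> [[_ gac] ma mb Hae] M0 HM.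
have mA : measurable (`[0%R, 1%R] : set R) by exact: measurable_itv.
have C0 : 0 < n.+1%:R * M by rewrite mulr_gt0 ?ltr0n.
apply: (@abs_continuous_le_integral R (fun s => (gamma s).2) (speed a b) _ 1 gac
  (speed_ge0 a b) (measurable_speed mA ma mb) C0); first by rewrite ler01 lexx.
apply: filterS Hae; first exact: (ae_filter_ringOfSetsType mu).
move=> s /= Hs s01; exists (horizontal_velocity a b (gamma s) s).2.
  exact/is_derive_height/Hs.
have {}s01 : 0 <= s <= 1 by move: s01; rewrite in_itv.
have h0 := speed_ge0 a b s.
(* Each j contributes at most (|b_j| |x_j| + |a_j| |y_j|) / 2 <= M times the speed, hence n M in
   total; [n.+1] makes the constant positive for every n. *)
apply: (@le_trans _ _ (\sum_(j < n) M * speed a b s)); last first.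
  rewrite sumr_const card_ord -[leLHS]mulr_natl mulrA ler_wpM2r// ler_wpM2r ?ler_nat//.
  exact: ltW.
rewrite horizontal_velocity_t; apply: le_trans (ler_norm_sum _ _ _) _.
apply: ler_sum => j _.
have -> : M * speed a b s = speed a b s * (M / 2) + speed a b s * (M / 2) by field.
apply: le_trans (ler_normB _ _) _; apply: lerD; rewrite !normrM; apply: ler_pM => //.
- exact: speed_geb.
- by rewrite (@ger0_norm _ 2^-1) ?invr_ge0// ler_pM2r ?invr_gt0// HM.
- exact: speed_gea.
- by rewrite (@ger0_norm _ 2^-1) ?invr_ge0// ler_pM2r ?invr_gt0// HM.
Qed.

Lemma cc_length_ge0 (a b : 'I_n -> R -> R) : (0 <= cc_length a b)%E.
Proof. by apply: integral_ge0 => s _; rewrite lee_fin sqrtr_ge0. Qed.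

Lemma cc_dist_ge0 p q : (0 <= cc_dist p q)%E.
Proof.
by apply: le_ereal_inf_tmp => _ [gamma [a [b [_ _ _ ->]]]]; exact: cc_length_ge0.
Qed.

Lemma cc_dist_lt_coord p q (r : R) i : (cc_dist p q < r%:E)%E -> `|q.1 0 i - p.1 0 i| <= r.
Proof.
move=> /ereal_inf_lt[_ [gamma [a [b [H <- <- ->]]]] /ltW Lr].
rewrite -lee_fin; apply: le_trans Lr; apply: horizontal_coord_bound H _.
by rewrite ler01 lexx.
Qed.

(** A curve of length below r moves each coordinate by less than r, so it stays in the box of size M
    + r, where the height bound applies. *)
Lemma cc_dist_lt_height p q (r M : R) : (cc_dist p q < r%:E)%E ->
  0 < M -> (forall i, `|p.1 0 i| <= M) -> `|q.2 - p.2| <= n.+1%:R * (M + r) * r.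
Proof.
move=> /ereal_inf_lt[_ [gamma [a [b [H <- <- ->]]]] Lr] M0 pM.
have r0 : 0 < r by rewrite -lte_fin; exact: le_lt_trans (cc_length_ge0 _ _) Lr.
have C0 : 0 <= n.+1%:R * (M + r) by rewrite mulr_ge0 ?ler0n// addr_ge0 ?ltW.
rewrite -lee_fin; apply: (@le_trans _ _ ((n.+1%:R * (M + r))%:E * cc_length a b)%E).
  apply: (horizontal_height_bound H); first exact: addr_gt0.
  move=> i x x01; rewrite -(subrK ((gamma 0).1 0 i) ((gamma x).1 0 i)) addrC.
  apply: le_trans (ler_normD _ _) _; apply: lerD => //.
  by rewrite -lee_fin; apply: le_trans (ltW Lr); exact: horizontal_coord_bound H x01.
by rewrite [leRHS]EFinM; apply: lee_wpmul2l; [rewrite lee_fin|exact: ltW].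
Qed.

End LowerBounds.


(** * Upper bounds for the metric from polynomial curves *)

Section UpperBounds.
Context {R : realType} {n : nat}.
Implicit Types (p q : heis R n) (gamma : R -> heis R n).
Local Notation mu := (@lebesgue_measure R).

Lemma abs_continuous_lipschitz (a b L : R) (f : R -> R) : 0 <= L ->
  (forall u v, a <= u <= b -> a <= v <= b -> `|f v - f u| <= L * `|v - u|) ->
  abs_continuous a b f.
Proof.
move=> L0 H e e0; have L10 : 0 < L + 1 by lra.
exists (e / (L + 1)); first by rewrite divr_gt0.
move=> k u v uv _; rewrite ltr_pdivlMr// => suv.
apply: le_lt_trans suv; rewrite mulr_suml; apply: ler_sum => i _.
have [au uvi vb] := uv i.
apply: le_trans (H (u i) (v i) _ _) _.
- by rewrite au (le_trans uvi).
- by rewrite vb (le_trans au).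
rewrite ger0_norm ?subr_ge0// mulrC ler_wpM2l ?subr_ge0//; lra.
Qed.

Lemma abs_continuous_horner (p : {poly R}) : abs_continuous 0 1 (horner p).
Proof.
(* The same L bounds the values of p as well, since the Lipschitz constant of p X + c involves
   them. *)
have [L L0 H] : exists2 L, 0 <= L & forall u v : R, 0 <= u <= 1 -> 0 <= v <= 1 ->
    `|p.[v] - p.[u]| <= L * `|v - u| /\ `|p.[u]| <= L.
  elim/poly_ind: p => [|p c [L L0 H]].
    by exists 0 => // u v _ _; rewrite !horner0 subrr normr0 mul0r.
  exists (L + L + `|c|) => [|u v u01 v01]; first by rewrite !addr_ge0.
  have [Huv Hu] := H _ _ u01 v01; have [_ Hv] := H _ _ v01 u01.
  rewrite !hornerE; split.
    have -> : p.[v] * v + c - (p.[u] * u + c) = (p.[v] - p.[u]) * v + p.[u] * (v - u).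
      by ring.
    apply: le_trans (ler_normD _ _) _; rewrite !normrM.
    have : `|p.[v] - p.[u]| * `|v| <= L * `|v - u|.
      apply: le_trans Huv; rewrite ler_piMr//; case/andP: v01 => v0 v1.
      by rewrite ger0_norm.
    have : `|p.[u]| * `|v - u| <= L * `|v - u| by rewrite ler_wpM2r.
    have : 0 <= `|c| * `|v - u| by rewrite mulr_ge0.
    lra.
  apply: le_trans (ler_normD _ _) _; rewrite lerD2r normrM.
  apply: (@le_trans _ _ `|p.[u]|); last lra.
  by rewrite ler_piMr//; case/andP: u01 => u0 u1; rewrite ger0_norm.
by apply: abs_continuous_lipschitz L0 _ => u v u01 v01; case: (H u v).
Qed.

Lemma is_derive_scalel {V : normedModType R} (f : R -> R) (v : V) (s df : R) :
  is_derive s (1 : R) f df -> is_derive s (1 : R) (fun s => f s *: v) (df *: v).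
Proof.
apply: (@is_derive_linear R R^o V (fun k : R => k *: v)) => [k|k l|k l] /=.
- exact: scalel_continuous.
- by rewrite scalerBl.
- by rewrite scalerA.
Qed.

Definition poly_curve (X : 'I_(n + n) -> {poly R}) (T : {poly R}) (s : R) : heis R n :=
  (\row_i (X i).[s], T.[s]).

Lemma is_derive_poly_curve X T (s : R) :
  is_derive s (1 : R) (poly_curve X T) (poly_curve (fun i => (X i)^`()) T^`() s).
Proof.
have E Y S x : poly_curve Y S x = \sum_(i < n + n) (Y i).[x] *: ((delta_mx 0 i, 0) : heis R n)
    + S.[x] *: ((0, 1) : heis R n).
  apply: injective_projections => /=.
    rewrite raddf_sum scaler0 addr0/=; apply/rowP => i; rewrite mxE summxE (bigD1 i)//=.
    rewrite !mxE !eqxx mulr1 big1 ?addr0// => j ji.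
    by rewrite !mxE eqxx eq_sym (negbTE ji) mulr0.
  rewrite raddf_sum/= big1 => [|i _]; last exact: scaler0.
  by rewrite add0r [_ *: _]mulr1.
rewrite E (_ : poly_curve X T =
  \sum_(i < n + n) (fun x => (X i).[x] *: ((delta_mx 0 i, 0) : heis R n))
  + (fun x => T.[x] *: ((0, 1) : heis R n))); last first.
  by apply/funext => x; rewrite E fctE fct_sumE.
apply: is_deriveD.
  by apply: is_derive_sum => i; exact: is_derive_scalel.
exact: is_derive_scalel.
Qed.

(** The controls are the derivatives of the x and y coordinates; the first hypothesis is the
    equation t' = (x y' - y x') / 2 that makes the curve horizontal, the second bounds its speed by
    c. *)
Lemma cc_dist_poly_le X T (c : R) :
  (forall s, T^`().[s] = \sum_(j < n)
    ((X (rshift n j))^`().[s] * ((X (lshift n j)).[s] / 2)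
     - (X (lshift n j))^`().[s] * ((X (rshift n j)).[s] / 2))) ->
  (forall s, 0 <= s <= 1 ->
    \sum_(j < n) ((X (lshift n j))^`().[s] ^+ 2 + (X (rshift n j))^`().[s] ^+ 2) <= c ^+ 2) ->
  0 <= c ->
  (cc_dist (poly_curve X T 0) (poly_curve X T 1) <= c%:E)%E.
Proof.
move=> HT Hc c0.
pose a j := horner (X (lshift n j))^`(); pose b j := horner (X (rshift n j))^`().
apply: (@le_trans _ _ (cc_length a b)).
  apply: ereal_inf_lbound; exists (poly_curve X T), a, b; split => //; split.
  - split; last exact: abs_continuous_horner.
    move=> i; rewrite (_ : (fun s => _) = horner (X i)); first exact: abs_continuous_horner.
    by apply/funext => s; rewrite mxE.
  - move=> j; apply: (measurable_funS measurableT) => //.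
    by apply: continuous_measurable_fun; exact: continuous_horner.
  - move=> j; apply: (measurable_funS measurableT) => //.
    by apply: continuous_measurable_fun; exact: continuous_horner.
  - apply: aeW => s _; rewrite -/(horizontal_velocity _ _ _ _).
    rewrite (_ : horizontal_velocity _ _ _ _ = poly_curve (fun i => (X i)^`()) T^`() s).
      exact: is_derive_poly_curve.
    apply: injective_projections.
      apply/rowP => i; rewrite /poly_curve mxE; case: (split_ordP i) => j ->.
        by rewrite horizontal_velocity_x.
      by rewrite horizontal_velocity_y.
    rewrite horizontal_velocity_t /poly_curve/= HT; apply: eq_bigr => j _.
    by rewrite /xcoord /ycoord !mxE.
rewrite /cc_length; apply: (@le_trans _ _ (\int[mu]_(s in `[0%R, 1%R]) (cst c%:E s))%E).
  apply: ge0_le_integral => //=.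
    - have mA : measurable (`[0%R, 1%R] : set R) by exact: measurable_itv.
    apply/measurable_EFinP; apply: (measurable_speed (a := a) (b := b) mA) => j;
    apply: (measurable_funS measurableT) => //;
    by apply: continuous_measurable_fun; exact: continuous_horner.
  move=> s; rewrite in_itv/= => s01; rewrite lee_fin -(ger0_norm c0) -sqrtr_sqr.
  by rewrite ler_wsqrtr// Hc.
by rewrite integral_cst//= lebesgue_measure_itv/= lte_fin ltr01 oppr0 adde0 mule1.
Qed.

Lemma dotr_split (z w : 'rV[R]_(n + n)) :
  dotr z w = \sum_(j < n) (xcoord z j * xcoord w j + ycoord z j * ycoord w j).
Proof. by rewrite /dotr big_split_ord/= -big_split. Qed.

Lemma dotr_ge0 (z : 'rV[R]_(n + n)) : 0 <= dotr z z.
Proof. by apply: sumr_ge0 => i _; rewrite -expr2 sqr_ge0. Qed.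

(** The curve s |-> q * (s w, 0) is horizontal with constant speed |w|. *)
Lemma cc_dist_horizontal_le q (w : 'rV[R]_(n + n)) :
  (cc_dist q (hmul q (w, 0%R)) <= (Num.sqrt (dotr w w))%:E)%E.
Proof.
pose X i := (q.1 0 i)%:P + (w 0 i) *: 'X : {poly R}.
pose T := (q.2)%:P + (omega q.1 w / 2) *: 'X : {poly R}.
have -> : hmul q (w, 0) = poly_curve X T 1.
  rewrite /poly_curve /X /T !hornerE/=; congr pair.
    by apply/rowP => i; rewrite !mxE !hornerE.
  by rewrite /= addr0.
have {1}-> : q = poly_curve X T 0.
  rewrite /poly_curve /X /T !hornerE/= [LHS]surjective_pairing; congr pair.
  by apply/rowP => i; rewrite mxE !hornerE.
have dX i s : (X i)^`().[s] = w 0 i by rewrite /X !poly.derivE !hornerE.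
apply: cc_dist_poly_le => [s|s _|]; last exact: sqrtr_ge0.
  rewrite /T !poly.derivE !hornerE /omega mulr_suml; apply: eq_bigr => j _.
  by rewrite !dX /X !hornerE /xcoord /ycoord /=; field.
rewrite sqr_sqrtr ?dotr_ge0// dotr_split; apply: ler_sum => j _.
by rewrite !dX !expr2.
Qed.

(* The loop [x = s - s^2], [y = x (1 - 2 s)] has [x y' - y x' = - 2 x^2], hence encloses
   the signed area [- 1 / 30]. *)
Lemma cc_dist_axis_le (j0 : 'I_n) (t t' : R) :
  (cc_dist ((0%R, t) : heis R n) ((0%R, t') : heis R n) <= (2 * Num.sqrt (30 * `|t' - t|))%:E)%E.
Proof.
pose r := Num.sqrt (30 * `|t' - t|).
have r2 : r ^+ 2 = 30 * `|t' - t| by rewrite sqr_sqrtr// mulr_ge0.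
(* Scaling x by k and y by r multiplies the enclosed area by k r, which must therefore be 30 (t -
   t'). The sign is carried by k, and |k| <= r. *)
pose k := - Num.sg (t' - t) * r.
have kr : k * r = 30 * (t - t').
  by rewrite /k -mulrA -expr2 r2 mulNr mulrCA -numEsg; ring.
have k2 : k ^+ 2 <= r ^+ 2.
  rewrite /k exprMn sqrrN ler_piMl ?sqr_ge0// sqr_sg.
  by case: (_ != 0).
have r0 : 0 <= r by exact: sqrtr_ge0.
rewrite -/r; clearbody k; clearbody r.
pose X i : {poly R} := if i == lshift n j0 then k *: ('X - 'X ^+ 2)
  else if i == rshift n j0 then r *: ('X - 3 *: 'X ^+ 2 + 2 *: 'X ^+ 3) else 0.
pose T : {poly R} := t%:P - (k * r) *: (3^-1 *: 'X ^+ 3 - 2^-1 *: 'X ^+ 4 + 5^-1 *: 'X ^+ 5).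
have Xx : X (lshift n j0) = k *: ('X - 'X ^+ 2) by rewrite /X eqxx.
have Xy : X (rshift n j0) = r *: ('X - 3 *: 'X ^+ 2 + 2 *: 'X ^+ 3).
  by rewrite /X eq_rlshift eqxx.
have Xx0 j : j != j0 -> X (lshift n j) = 0.
  by rewrite /X eq_lshift eq_lrshift => /negbTE->.
have Xy0 j : j != j0 -> X (rshift n j) = 0.
  by rewrite /X eq_rshift eq_rlshift => /negbTE->.
(* The condition s^2 = s treats both endpoints 0 and 1 at once: the loop closes. *)
have X0 i (s : R) : s ^+ 2 = s -> (X i).[s] = 0.
  move=> ss.
  rewrite /X; case: ifP => _; [|case: ifP => _].
  - by rewrite !hornerE/= ss subrr mulr0.
  - by rewrite !hornerE/= -!mulrA -!expr2 !ss -expr2 ss; ring.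
  - by rewrite horner0.
have -> : ((0, t) : heis R n) = poly_curve X T 0.
  rewrite /poly_curve /T !hornerE; congr pair; last by rewrite /=; ring.
  by apply/rowP => i; rewrite !mxE X0// expr0n.
have -> : ((0, t') : heis R n) = poly_curve X T 1.
  rewrite /poly_curve /T !hornerE; congr pair; last by rewrite /= kr; field.
  by apply/rowP => i; rewrite !mxE X0// expr1n.
apply: cc_dist_poly_le => [s|s /andP[s0 s1]|]; last by rewrite mulr_ge0.
  rewrite (bigD1 j0)//= big1 => [|j jj0]; last first.
    by rewrite Xx0// Xy0// deriv0 horner0; ring.
  by rewrite Xx Xy /T !poly.derivE !hornerE /=; field.
rewrite (bigD1 j0)//= big1 => [|j jj0]; last first.
  by rewrite Xx0// Xy0// deriv0 horner0; ring.
rewrite Xx Xy !poly.derivE !hornerE /=.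
(* With u = s (1 - s), the unscaled derivatives satisfy x'^2 = 1 - 4 u and y' = 1 - 6 u, and 0 <= u
   <= 1/3 is exactly (1 - 6 u)^2 <= 1. *)
have ss : 0 <= s * (1 - s) <= 1 / 3.
  apply/andP; split; first by rewrite mulr_ge0// subr_ge0.
  have : 0 <= (s - 2^-1) ^+ 2 by exact: sqr_ge0.
  lra.
have A : (1 - (s + s)) ^+ 2 <= 1.
  have -> : (1 - (s + s)) ^+ 2 = 1 - 4 * (s * (1 - s)) by ring.
  by move: ss => /andP[? _]; lra.
have B : (1 - 3 * (s + s) + 2 * (s * s + s * (s + s))) ^+ 2 <= 1.
  have : 0 <= s * (1 - s) * (1 / 3 - s * (1 - s)).
    by case/andP: ss => ? ?; rewrite mulr_ge0// subr_ge0.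
  lra.
rewrite !exprMn; apply: (@le_trans _ _ (r ^+ 2 * 1 + r ^+ 2 * 1)).
  by apply: lerD; apply: ler_pM; rewrite ?sqr_ge0.
by have := sqr_ge0 r; lra.
Qed.
End UpperBounds.


(** * Curves that are Hölder continuous of exponent 1/2 have dimension at most 2 *)

Section SnowflakeCurve.
Context {R : realType} {T : Type} (d : T -> T -> \bar R) (f : R -> T) (c : R)
  (d_ge0 : forall x y, (0 <= d x y)%E) (c_gt0 : 0 < c)
  (df : forall t t', (d (f t) (f t') <= (c * Num.sqrt `|t' - t|)%:E)%E).

(** Cutting the segment into M^2 equal parts gives images of diameter at most K / M, hence total
    weight at most K^2 (K / M)^(s - 2), which tends to 0. *)
Lemma hausdorff_null_snowflake_seg (s a l : R) : 2 < s -> 0 < l ->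
  hausdorff_null d s (f @` `[a, a + l[%classic).
Proof.
move=> s2 l0 delta e d0 e0.
pose K := c * Num.sqrt l; have K0 : 0 < K by rewrite mulr_gt0// sqrtr_gt0.
have s20 : 0 < s - 2 by rewrite subr_gt0.
pose eps := e / 2 / K ^+ 2.
have eps0 : 0 < eps by rewrite !divr_gt0// exprn_gt0.
(* Once K / M <= x, diameters are below [delta] and the total weight is at most K^2 eps = e / 2. *)
pose x := Order.min delta (eps `^ (s - 2)^-1).
have x0 : 0 < x by rewrite lt_min d0 powR_gt0.
pose M := (Num.truncn (K / x)).+1.
have M0 : 0 < M%:R :> R by rewrite ltr0n.
have KM : K / M%:R <= x.
  rewrite ler_pdivrMr// mulrC -ler_pdivrMr//; apply: ltW.
  by rewrite /M; apply: real_truncnS_gt; exact: num_real.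
pose h := l / M%:R ^+ 2.
have h0 : 0 < h by rewrite divr_gt0// exprn_gt0.
pose U i := if (i < M ^ 2)%N then f @` [set t | a + h * i%:R <= t <= a + h * i.+1%:R] else set0.
have Udiam i : (diam d (U i) <= (K / M%:R)%:E)%E.
  rewrite /U; case: ifP => _; last by rewrite diam_set0 leNye.
  apply: ge_ereal_sup => _ [_ [t /andP[t1 t2] <-] [_ [t' /andP[t1' t2'] <-] <-]].
  apply: le_trans (df _ _) _; rewrite lee_fin /K -mulrA ler_pM2l//.
  have <- : Num.sqrt h = Num.sqrt l / M%:R.
    by rewrite /h sqrtrM ?ltW// sqrtrV ?exprn_ge0 ?ler0n// sqrtr_sqr ger0_norm ?ler0n.
  rewrite ler_wsqrtr// ler_norml.
  move: t1 t2 t1' t2'; rewrite -natr1 mulrDr mulr1 => t1 t2 t1' t2'.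
  by apply/andP; split; lra.
exists U; split.
- move=> y [t /= + <-{y}]; rewrite in_itv/= => /andP[ta tal].
  have th0 : 0 <= (t - a) / h by apply: divr_ge0; [rewrite subr_ge0|exact: ltW].
  have /andP[i1 i2] := truncn_itv th0.
  have iM : (Num.truncn ((t - a) / h) < M ^ 2)%N.
    rewrite truncn_lt_nat// ltr_pdivrMr// /h natrX mulrCA divff ?mulr1 ?expf_neq0 ?gt_eqF//.
    by rewrite ltrBlDl.
  exists (Num.truncn ((t - a) / h)) => //; rewrite /U iM; exists t => //=.
  move: i1 i2; rewrite ler_pdivlMr// ltr_pdivrMr// lerBrDl mulrC => -> /=.
  by rewrite ltrBlDl mulrC => /ltW.
- move=> i; apply: le_trans (Udiam i) _; rewrite lee_fin; apply: le_trans KM _.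
  by rewrite ge_min lexx.
rewrite (nneseries_split _ (M ^ 2)); last by move=> *; exact: diam_pow_ge0.
rewrite add0n [X in (_ + X)%E]eseries0 ?adde0; last first.
  by move=> i Mi _; rewrite /U ltnNge Mi/= diam_pow0.
apply: (@le_lt_trans _ _ (\sum_(0 <= i < M ^ 2) ((K / M%:R) `^ s)%:E)%E).
  apply: lee_sum => i _; have [->|/set0P U0] := eqVneq (U i) set0.
    by rewrite diam_pow0 lee_fin powR_ge0.
  rewrite diam_powE// -poweR_EFin; apply: gt0_ler_poweR; rewrite ?in_itv/= ?leey ?andbT//.
  - by lra.
  - exact: diam_ge0.
  - by rewrite lee_fin divr_ge0 ?ltW.
rewrite sumEFin lte_fin big_const_nat subn0 iter_addr_0 -[_ *+ (M ^ 2)]mulr_natl natrX.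
have -> : s = 2 + (s - 2) by ring.
have KM0 : 0 < K / M%:R by rewrite divr_gt0.
rewrite powRD; last by rewrite (gt_eqF KM0) implybT.
rewrite powR_mulrn ?ltW// mulrA -exprMn mulrCA divff ?gt_eqF// mulr1.
apply: (@le_lt_trans _ _ (K ^+ 2 * eps)).
  rewrite ler_pM2l ?exprn_gt0//.
  have -> : eps = (eps `^ (s - 2)^-1) `^ (s - 2).
    by rewrite -powRrM mulVf ?gt_eqF// powRr1// ltW.
  apply: ge0_ler_powR; [exact: ltW|rewrite nnegrE; exact: ltW|by rewrite nnegrE powR_ge0|].
  by apply: le_trans KM _; rewrite ge_min lexx orbT.
by rewrite /eps mulrCA divff ?expf_neq0 ?gt_eqF//; lra.
Qed.

Lemma hausdorff_dim_snowflake_le : (hausdorff_dim d (range f) <= 2%:E)%E.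
Proof.
have -> : range f = \bigcup_i (f @` `[- i%:R, - i%:R + (2 * i.+1%:R)[%classic).
  apply/seteqP; split=> [_ [t _ <-]|_ [i _ [t _ <-]]]; last by exists t.
  have H := real_truncnS_gt (num_real `|t|).
  exists (Num.truncn `|t|).+1 => //; exists t => //=; rewrite in_itv/=.
  by move: H; rewrite ltr_norml -!natr1 => /andP[? ?]; apply/andP; split; lra.
apply: hausdorff_dim_bigcup_le => // i.
apply/lee_addgt0Pr => e e0; rewrite -EFinD; apply: hausdorff_dim_le; first by lra.
by apply: hausdorff_null_snowflake_seg; [lra|rewrite mulr_gt0].
Qed.

End SnowflakeCurve.

(** * From local to global dimension bounds, and concentration off the axis *)

Section RationalBalls.
Context {R : realType} {n : nat}.
Implicit Types (p q : heis R n) (A : set (heis R n)).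

Lemma le_hausdorff_dim_sub (d : heis R n -> heis R n -> \bar R) A B : A `<=` B ->
  (hausdorff_dim d A <= hausdorff_dim d B)%E.
Proof. by move=> AB; apply: le_hausdorff_dim => s _; exact: sub_hausdorff_null. Qed.

Definition rational_point (c : 'rV[rat]_(n + n) * rat) : heis R n :=
  (map_mx ratr c.1, ratr c.2).

Lemma rational_ball p (e : R) : 0 < e -> exists c (k : nat),
  ball (rational_point c) k.+1%:R^-1 p /\ ball (rational_point c) k.+1%:R^-1 `<=` ball p e.
Proof.
move=> e0; pose k := Num.truncn (2 / e).
have Hlt (y : R) : y - k.+1%:R^-1 < y + k.+1%:R^-1.
  by rewrite ltrD2l gtrN// invr_gt0.
have k0 : 0 < k.+1%:R^-1 :> R by rewrite invr_gt0.
have ke : k.+1%:R^-1 <= e / 2.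
  rewrite -[leRHS]invrK lef_pV2 ?posrE ?invr_gt0 ?divr_gt0// invf_div; apply: ltW.
  by apply: real_truncnS_gt; exact: num_real.
have /choice[z Hz] : forall i, exists x : rat, ball (ratr x : R) k.+1%:R^-1 (p.1 0 i).
  move=> i; have [|x] := @rat_in_itvoo R (p.1 0 i - k.+1%:R^-1) (p.1 0 i + k.+1%:R^-1).
    exact: Hlt.
  rewrite in_itv/= => /andP[x1 x2]; exists x.
  by rewrite /ball/= distrC ltr_distlC; apply/andP.
have [t Ht] : exists x : rat, ball (ratr x : R) k.+1%:R^-1 p.2.
  have [|x] := @rat_in_itvoo R (p.2 - k.+1%:R^-1) (p.2 + k.+1%:R^-1); first exact: Hlt.
  rewrite in_itv/= => /andP[x1 x2]; exists x.
  by rewrite /ball/= distrC ltr_distlC; apply/andP.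
have H : ball (rational_point (\row_i z i, t)) k.+1%:R^-1 p.
  by split => //=; split => // i j; rewrite !mxE ord1; exact: Hz.
exists (\row_i z i, t), k; split => // q Hq.
by apply: (ball_splitr (z := rational_point (\row_i z i, t))); apply: le_ball ke _ _.
Qed.

(** A Lindelöf argument: each point of [A] outside [B] lies in a rational ball in which [A] has
    dimension at most a. There are countably many such balls, and dimension is countably stable. *)
Lemma hausdorff_dim_local (d : heis R n -> heis R n -> \bar R) (a : R) A B :
  (forall x y, (0 <= d x y)%E) -> 0 <= a -> (hausdorff_dim d B <= a%:E)%E ->
  (forall p, A p -> ~ B p -> exists2 e : R, 0 < e & (hausdorff_dim d (A `&` ball p e) <= a%:E)%E) ->
  (hausdorff_dim d A <= a%:E)%E.
Proof.
move=> d0 a0 HB HA.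
pose D (x : 'rV[rat]_(n + n) * rat * nat) := A `&` ball (rational_point x.1) x.2.+1%:R^-1.
(* Indices that code no ball, or a ball where the bound fails, are filled with [B], whose dimension
   is already controlled. *)
pose E (i : nat) := if unpickle i is Some x then
  if `[< (hausdorff_dim d (D x) <= a%:E)%E >] then D x else B else B.
apply: (@le_trans _ _ (hausdorff_dim d (B `|` \bigcup_i E i))).
  apply: le_hausdorff_dim_sub => p Ap; have [Bp|nBp] := pselect (B p); first by left.
  right; have [e e0 He] := HA p Ap nBp; have [c [k [Hp ck]]] := rational_ball p e0.
  exists (pickle (c, k)) => //; rewrite /E pickleK asboolT; last first.
    by apply: le_trans He; apply: le_hausdorff_dim_sub => q [Aq Hq]; split => //; exact: ck.
  by split.
have -> : B `|` \bigcup_i E i = \bigcup_i (B `|` E i).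
  apply/seteqP; split => [x [Bx|[i _ Ex]]|x [i _ [Bx|Ex]]].
  - by exists 0%N => //; left.
  - by exists i => //; right.
  - by left.
  - by right; exists i.
apply: hausdorff_dim_bigcup_le => // i.
have -> : B `|` E i = \bigcup_j (if j is 0%N then B else E i).
  apply/seteqP; split => [x [Bx|Ex]|x [[|j] _ Hx]].
  - by exists 0%N.
  - by exists 1%N.
  - by left.
  - by right.
apply: hausdorff_dim_bigcup_le => // -[//|_].
by rewrite /E; case: unpickle => // x; case: asboolP.
Qed.

Lemma hausdorff_dim_axis_le (j0 : 'I_n) :
  (hausdorff_dim cc_dist [set p : heis R n | p.1 = 0%R] <= 2%:E)%E.
Proof.
have -> : [set p : heis R n | p.1 = 0] = range (fun t : R => (0, t) : heis R n).
  by apply/seteqP; split => [[z t] /= ->|_ [t _ <-]//]; exists t.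
apply: (@hausdorff_dim_snowflake_le _ _ _ _ (2 * Num.sqrt 30)).
- exact: cc_dist_ge0.
- by rewrite mulr_gt0// sqrtr_gt0.
- by move=> t t'; rewrite -mulrA -sqrtrM//; exact: cc_dist_axis_le.
Qed.

(** Otherwise every point of [A] off the t-axis has a ball of small dimension, while the axis itself
    has dimension at most 2 <= a. *)
Lemma cc_dim_concentration (j0 : 'I_n) (a : R) A : 2 <= a ->
  (a%:E < hausdorff_dim cc_dist A)%E ->
  exists p : heis R n, p.1 != 0 /\
    forall e : R, 0 < e -> (a%:E < hausdorff_dim cc_dist (A `&` ball p e))%E.
Proof.
move=> a2 dimA; apply: contrapT => H.
move: dimA; apply/negP; rewrite -leNgt.
apply: (@hausdorff_dim_local _ _ _ [set p | p.1 = 0%R]).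
- exact: cc_dist_ge0.
- by lra.
- by apply: le_trans (hausdorff_dim_axis_le j0) _; rewrite lee_fin.
move=> p Ap /eqP p0; apply: contrapT => Hp; apply: H; exists p; split => // e e0.
by rewrite ltNge; apply/negP => dimp; apply: Hp; exists e.
Qed.

End RationalBalls.


(** * Orthogonal projection onto a subspace *)

Section OrthogonalProjection.
Context {R : realType} {n : nat}.
Implicit Types (u v w z : 'rV[R]_(n + n)) (V : {vspace 'rV[R]_(n + n)}).

Lemma dotrDl z w v : dotr (z + w) v = dotr z v + dotr w v.
Proof. by rewrite /dotr -big_split; apply: eq_bigr => i _; rewrite !mxE mulrDl. Qed.

Lemma dotrZl k z v : dotr (k *: z) v = k * dotr z v.
Proof. by rewrite /dotr mulr_sumr; apply: eq_bigr => i _; rewrite !mxE mulrA. Qed.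

Lemma dotrC z w : dotr z w = dotr w z.
Proof. by apply: eq_bigr => i _; rewrite mulrC. Qed.

Lemma dotrDr v z w : dotr v (z + w) = dotr v z + dotr v w.
Proof. by rewrite dotrC dotrDl !(dotrC v). Qed.

Lemma dotrZr k v z : dotr v (k *: z) = k * dotr v z.
Proof. by rewrite dotrC dotrZl (dotrC v). Qed.

Lemma dotrNl z v : dotr (- z) v = - dotr z v.
Proof. by rewrite -scaleN1r dotrZl mulN1r. Qed.

Lemma dotrBl z w v : dotr (z - w) v = dotr z v - dotr w v.
Proof. by rewrite dotrDl dotrNl. Qed.

Lemma dotr_eq0 z : dotr z z = 0 -> z = 0.
Proof.
move=> /eqP; rewrite psumr_eq0 => [/allP H|i _]; last by rewrite -expr2 sqr_ge0.
apply/rowP => i; rewrite mxE; have := H i; rewrite mem_index_enum => /(_ isT) /=.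
by rewrite mulf_eq0 orbb => /eqP.
Qed.

Lemma orth_decomposition V z : exists w, w \in V /\ forall v, v \in V -> dotr (z - w) v = 0.
Proof.
rewrite -(span_basis (vbasisP V)); elim: (tval (vbasis V)) z => [|x xs IH] z.
  exists 0; split; first exact: mem0v.
  by move=> v; rewrite span_nil memv0 => /eqP ->; rewrite -(scale0r 0) dotrZr mul0r.
have [w [ws Hw]] := IH z; have [y [ys Hy]] := IH x.
have in_span v : v \in <<xs>>%VS -> v \in <<x :: xs>>%VS.
  by rewrite span_cons => vs; rewrite -(add0r v) memv_add// mem0v.
(* A Gram-Schmidt step. If x lies in the span of [xs], then x' = 0 and k = 0 by the convention for
   division by 0. *)
pose x' := x - y; pose k := dotr z x' / dotr x' x'.
have x'in : x' \in <<x :: xs>>%VS by apply: memvB; [apply/memv_span/mem_head|exact: in_span].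
have kx' : dotr z x' - k * dotr x' x' = 0.
  have [/dotr_eq0 E|nz] := eqVneq (dotr x' x') 0.
    by rewrite E -(scale0r 0) !dotrZr !mul0r mulr0 subrr.
  by rewrite divfK// subrr.
have wx' : dotr w x' = 0 by rewrite dotrC Hy.
have orthx' : dotr (z - (w + k *: x')) x' = 0.
  by rewrite dotrBl dotrDl wx' add0r dotrZl.
exists (w + k *: x'); split; first by apply: memvD; [exact: in_span|exact: memvZ].
have orths v : v \in <<xs>>%VS -> dotr (z - (w + k *: x')) v = 0.
  by move=> vs; rewrite opprD addrA dotrBl Hw// dotrZl Hy// mulr0 subrr.
move=> v; rewrite span_cons => /memv_addP[_ /vlineP[c ->] [t ts ->]].
by rewrite dotrDr dotrZr (orths t ts) -(subrK y x) dotrDr orthx' (orths y ys) !addr0 mulr0.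
Qed.

Lemma orth_projP V z : orth_proj V z \in V /\
  forall v, v \in V -> dotr (z - orth_proj V z) v = 0.
Proof.
by rewrite /orth_proj; case: xgetP => [w -> //|H]; case: (orth_decomposition V z) => w /H.
Qed.

(** Writes v through the rows of the projection matrix without invoking linearity of the chosen
    [orth_proj]: the difference of the two sides lies in [V] and is orthogonal to [V]. *)
Lemma orth_proj_id V v : v \in V -> v = \sum_i v 0 i *: orth_proj V (delta_mx 0 i).
Proof.
move=> vV; set w := \sum_i _; apply/eqP; rewrite -subr_eq0; apply/eqP/dotr_eq0.
have wV : w \in V by apply: memv_suml => i _; rewrite memvZ// (orth_projP _ _).1.
have {2}-> : v - w = \sum_i v 0 i *: (delta_mx 0 i - orth_proj V (delta_mx 0 i)).
  by rewrite {1}(row_sum_delta v) -sumrB; apply: eq_bigr => i _; rewrite scalerBr.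
have vwV : v - w \in V by rewrite memvB.
elim/big_ind : _ => [|x y Hx Hy|i _].
- by rewrite -(scale0r 0) dotrZr mul0r.
- by rewrite dotrDr Hx Hy addr0.
- by rewrite dotrZr dotrC (orth_projP V _).2 ?mulr0.
Qed.

Lemma hprojR_orth V (p : heis R n) v : v \in V -> dotr (hprojR V p).1 v = 0.
Proof. by move=> vV; rewrite /hprojR/= addrC (orth_projP V _).2. Qed.

End OrthogonalProjection.

(** * Bilinearity and coordinate bounds for the symplectic form *)

Section Omega.
Context {R : realType} {n : nat}.
Implicit Types (u v w z : 'rV[R]_(n + n)).

Lemma omegaDr z w w' : omega z (w + w') = omega z w + omega z w'.
Proof.
rewrite /omega -big_split; apply: eq_bigr => j _.
by rewrite /xcoord /ycoord !mxE /=; ring.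
Qed.

Lemma omegaDl z w w' : omega (z + w) w' = omega z w' + omega w w'.
Proof.
rewrite /omega -big_split; apply: eq_bigr => j _.
by rewrite /xcoord /ycoord !mxE /=; ring.
Qed.

Lemma omegaZl k z w : omega (k *: z) w = k * omega z w.
Proof.
rewrite /omega mulr_sumr; apply: eq_bigr => j _.
by rewrite /xcoord /ycoord !mxE /=; ring.
Qed.

Lemma omegaZr k z w : omega z (k *: w) = k * omega z w.
Proof.
rewrite /omega mulr_sumr; apply: eq_bigr => j _.
by rewrite /xcoord /ycoord !mxE /=; ring.
Qed.

Lemma omegaNr z w : omega z (- w) = - omega z w.
Proof. by rewrite -scaleN1r omegaZr mulN1r. Qed.

Lemma omegazz z : omega z z = 0.
Proof. by rewrite /omega big1// => j _; ring. Qed.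

Lemma omega_bound (K L : R) z w : (forall i, `|z 0 i| <= K) -> (forall i, `|w 0 i| <= L) ->
  `|omega z w| <= (n + n)%:R * (K * L).
Proof.
move=> zK wL; apply: le_trans (ler_norm_sum _ _ _) _.
rewrite natrD mulrDl.
have -> : n%:R * (K * L) + n%:R * (K * L) = \sum_(j < n) (K * L + K * L).
  by rewrite sumr_const card_ord -[RHS]mulr_natl mulrDr.
apply: ler_sum => j _; apply: le_trans (ler_normB _ _) _.
by apply: lerD; rewrite normrM; apply: ler_pM => //; solve [exact: zK|exact: wL].
Qed.

Lemma dotr_bound (K : R) z : (forall i, `|z 0 i| <= K) -> dotr z z <= (n + n)%:R * K ^+ 2.
Proof.
move=> zK; rewrite mulr_natl -[in X in _ *+ X](card_ord (n + n)) -sumr_const.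
apply: ler_sum => i _; rewrite -expr2 -real_normK ?num_real//.
by rewrite lerXn2r ?nnegrE// (le_trans _ (zK i)).
Qed.

Lemma sqr_coord_le z i : z 0 i ^+ 2 <= dotr z z.
Proof.
rewrite /dotr (bigD1 i)//= expr2 lerDl; apply: sumr_ge0 => j _.
by rewrite -expr2 sqr_ge0.
Qed.

Lemma coord_le (L : R) z i : 0 <= L -> dotr z z <= L ^+ 2 -> `|z 0 i| <= L.
Proof.
move=> L0 zL; rewrite -sqrtr_sqr -(ger0_norm L0) -[leRHS]sqrtr_sqr ler_wsqrtr//.
exact: le_trans (sqr_coord_le z i) zL.
Qed.

End Omega.

(** * Quotient metric against Euclidean metric *)

Section QuotientMetric.
Context {R : realType} {n : nat} (V : {vspace 'rV[R]_(n + n)}).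
Implicit Types (p q : heis R n) (v z : 'rV[R]_(n + n)).
Local Notation N := ((n + n)%:R : R).

Lemma quot_dist_ge0 p q : (0 <= quot_dist V p q)%E.
Proof. by apply: le_ereal_inf_tmp => _ [v _ <-]; exact: cc_dist_ge0. Qed.

Lemma euclid_dist_ge0 p q : (0 <= euclid_dist p q)%E.
Proof. by rewrite lee_fin sqrtr_ge0. Qed.

(** Allows N in place of its square root, which keeps the constants free of roots. *)
Lemma natr_sqr_le : N <= N ^+ 2.
Proof. by rewrite -natrX ler_nat; case: (n + n)%N => // k; exact: leq_pmulr. Qed.

Lemma euclid_dist_le (a b : R) p q : 0 <= a -> 0 <= b ->
  dotr (p.1 - q.1) (p.1 - q.1) <= N * a ^+ 2 -> `|p.2 - q.2| <= b ->
  (euclid_dist p q <= (N * a + b)%:E)%E.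
Proof.
move=> a0 b0 Ha Hb; have Na0 : 0 <= N * a by rewrite mulr_ge0.
rewrite lee_fin -[leRHS]ger0_norm ?addr_ge0// -sqrtr_sqr ler_wsqrtr// [leRHS]sqrrD.
rewrite -[X in _ + X <= _]real_normK ?num_real//; apply: lerD; last by rewrite lerXn2r ?nnegrE.
apply: le_trans Ha _; rewrite exprMn -[leLHS]addr0; apply: lerD.
  by rewrite ler_wpM2r ?sqr_ge0// natr_sqr_le.
by rewrite mulrn_wge0// mulr_ge0.
Qed.

(* Projecting the base curve to [V] and to its complement bounds both the translation
   [v] and the horizontal displacement by the length. *)
Lemma euclid_le_quot_lt (K r : R) p q : 0 <= K ->
  (forall v, v \in V -> dotr p.1 v = 0) -> (forall v, v \in V -> dotr q.1 v = 0) ->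
  (forall i, `|p.1 0 i| <= K) -> 0 < r < 1 -> (quot_dist V p q < r%:E)%E ->
  (euclid_dist p q <= ((N + (n.+1%:R * (N + K + 2) + N * (N * K))) * r)%:E)%E.
Proof.
move=> K0 pV qV pK /andP[r0 r1] /ereal_inf_lt[_ [v /= vV <-] Hr].
pose u := q.1 - (v + p.1).
have ur i : `|u 0 i| <= r by have := cc_dist_lt_coord i Hr; rewrite !mxE.
have uu := dotr_bound ur.
have pyth : dotr u u = dotr (p.1 - q.1) (p.1 - q.1) + dotr v v.
  have av : dotr (p.1 - q.1) v = 0 by rewrite dotrBl pV// qV// subrr.
  have -> : u = - ((p.1 - q.1) + v) by apply/rowP => i; rewrite /u !mxE; ring.
  move: (p.1 - q.1) av => a av.
  by rewrite dotrNl dotrC dotrNl opprK dotrDl !dotrDr (dotrC v) av addr0 add0r.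
have pp : dotr (p.1 - q.1) (p.1 - q.1) <= N * r ^+ 2.
  by have := dotr_ge0 v; lra.
have vv i : `|v 0 i| <= N * r.
  apply: coord_le; first by rewrite mulr_ge0// ltW.
  have := dotr_ge0 (p.1 - q.1).
  have : N * r ^+ 2 <= (N * r) ^+ 2 by rewrite exprMn ler_wpM2r ?sqr_ge0// natr_sqr_le.
  lra.
have N0 : 0 <= N by [].
have Nr : N * r <= N by rewrite ler_piMr// ltW.
have M0 : 0 < N + K + 1 by rewrite ltr_wpDl// addr_ge0.
have pM i : `|(hmul (v, 0) p).1 0 i| <= N + K + 1.
  rewrite /= mxE; apply: le_trans (ler_normD _ _) _.
  by have := vv i; have := pK i; lra.
have Ht := cc_dist_lt_height Hr M0 pM.
rewrite [X in (_ <= X)%E](_ : _ =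
  (N * r + (n.+1%:R * (N + K + 2) + N * (N * K)) * r)%:E); last first.
  by congr EFin; ring.
apply: euclid_dist_le => //; first exact: ltW.
  by rewrite mulr_ge0 ?(ltW r0)// addr_ge0// !mulr_ge0// !addr_ge0.
have Hom := omega_bound vv pK.
have -> : p.2 - q.2 = - (omega v p.1 / 2) - (q.2 - (hmul (v, 0) p).2).
  by rewrite /=; ring.
apply: le_trans (ler_normB _ _) _; rewrite normrN addrC mulrDl; apply: lerD.
  apply: le_trans Ht _; rewrite ler_wpM2r ?(ltW r0)// ler_wpM2l//; lra.
rewrite normrM (@ger0_norm _ 2^-1) ?invr_ge0//.
have := normr_ge0 (omega v p.1); move: Hom; set x := `|_|; nra.
Qed.

Lemma euclid_le_quot (K : R) : 0 <= K -> exists2 C : R, 0 < C & forall p q,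
  (forall v, v \in V -> dotr p.1 v = 0) -> (forall v, v \in V -> dotr q.1 v = 0) ->
  (forall i, `|p.1 0 i| <= K) -> (forall i, `|q.1 0 i| <= K) ->
  `|p.2| <= K -> `|q.2| <= K ->
  (euclid_dist p q <= C%:E * quot_dist V p q)%E.
Proof.
move=> K0; pose A := N + (n.+1%:R * (N + K + 2) + N * (N * K)).
pose D := N * (2 * K) + 2 * K.
have N0 : 0 <= N by [].
have A0 : 0 <= A by rewrite !addr_ge0// !mulr_ge0// !addr_ge0.
have D0 : 0 <= D by rewrite addr_ge0// !mulr_ge0.
have C0 : 0 < A + D + 1 by lra.
exists (A + D + 1) => // p q pV qV pK qK p2K q2K.
have key r : 0 < r -> (quot_dist V p q < r%:E)%E ->
    (euclid_dist p q <= ((A + D + 1) * r)%:E)%E.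
  move=> r0 Hr; have [r1|r1] := ltP r 1.
    apply: le_trans (euclid_le_quot_lt K0 pV qV pK _ Hr) _; first by rewrite r0 r1.
    by rewrite lee_fin -/A ler_wpM2r ?(ltW r0)//; lra.
  apply: (@le_trans _ _ D%:E).
    apply: euclid_dist_le; rewrite ?mulr_ge0//.
      apply: dotr_bound => i; rewrite !mxE; apply: le_trans (ler_normB _ _) _.
      by have := pK i; have := qK i; lra.
    by apply: le_trans (ler_normB _ _) _; lra.
  rewrite lee_fin; apply: (@le_trans _ _ (A + D + 1)); first by lra.
  by rewrite ler_peMr// ltW.
have := quot_dist_ge0 p q; case E : (quot_dist V p q) => [x||]// => [|_]; last first.
  by rewrite mulry gtr0_sg// mul1e leey.
rewrite lee_fin => x0; rewrite -EFinM; apply/lee_addgt0Pr => e e0.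
have e'0 : 0 < e / (A + D + 1) by rewrite divr_gt0.
apply: le_trans (key (x + e / (A + D + 1)) _ _) _.
- by rewrite ltr_wpDl.
- by rewrite E lte_fin ltrDl.
- by rewrite -EFinD lee_fin mulrDr lerD2l mulrCA divff ?mulr1// gt_eqF.
Qed.

Lemma hausdorff_dim_euclid_le_quot (A : set (heis R n)) :
  (hausdorff_dim euclid_dist (hprojR V @` A) <= hausdorff_dim (quot_dist V) (hprojR V @` A))%E.
Proof.
apply: le_hausdorff_dim => s s0 Hs.
pose B (k : nat) := hprojR V @` A `&`
  [set p : heis R n | (forall i, `|p.1 0 i| <= k%:R) /\ `|p.2| <= k%:R].
have -> : hprojR V @` A = \bigcup_k B k.
  apply/seteqP; split=> [p Ap|p [k _ []//]].
  pose k := Num.truncn (`|p.2| + \sum_i `|p.1 0 i|).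
  have Hk : `|p.2| + \sum_i `|p.1 0 i| <= k.+1%:R.
    by apply: ltW; apply: real_truncnS_gt; exact: num_real.
  have S0 : 0 <= \sum_i `|p.1 0 i| by apply: sumr_ge0.
  exists k.+1 => //; split => //; split; last by lra.
  move=> i; apply: le_trans Hk; rewrite (bigD1 i)//= addrCA lerDl.
  by rewrite addr_ge0//; apply: sumr_ge0.
apply: hausdorff_null_bigcup => k.
have [C C0 HC] := @euclid_le_quot k%:R (ler0n _ _).
apply: (@hausdorff_null_lipschitz _ _ (quot_dist V) _ _ C) => //.
- exact: quot_dist_ge0.
- exact: euclid_dist_ge0.
- move=> p q /set_mem[[p' _ <-] [pk p2k]] /set_mem[[q' _ <-] [qk q2k]].
  by apply: HC => // v; exact: hprojR_orth.
- by apply: sub_hausdorff_null Hs => p [].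
Qed.

(* Left translation by a multiple of [v0] corrects the heights, so that the translate of
   [p] and [q] are joined by a horizontal segment. *)
Lemma quot_le_euclid (K L : R) (v0 : 'rV[R]_(n + n)) p q : 0 <= K -> 0 <= L -> v0 \in V ->
  (forall i, `|v0 0 i| <= L) -> (forall i, `|p.1 0 i| <= K) -> 1 <= omega v0 (p.1 + q.1) ->
  (quot_dist V p q <= (N * (1 + (2 + N * K) * L) + 1)%:E * euclid_dist p q)%E.
Proof.
move=> K0 L0 v0V v0L pK pq1; rewrite /euclid_dist.
have N0 : 0 <= N by [].
set S := _ + _ ^+ 2; pose E := Num.sqrt S; rewrite -/E.
have E0 : 0 <= E by exact: sqrtr_ge0.
have S0 : 0 <= S by rewrite addr_ge0 ?dotr_ge0 ?sqr_ge0.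
have E2 : E ^+ 2 = S by rewrite sqr_sqrtr.
have pqE i : `|q.1 0 i - p.1 0 i| <= E.
  rewrite distrC; have := @coord_le _ _ E (p.1 - q.1) i E0; rewrite !mxE; apply.
  by rewrite E2 lerDl sqr_ge0.
have p2E : `|q.2 - p.2| <= E.
  by rewrite distrC -sqrtr_sqr ler_wsqrtr// lerDr dotr_ge0.
pose W := omega v0 (p.1 + q.1); have W0 : 0 < W by exact: lt_le_trans pq1.
pose l := (2 * (q.2 - p.2) - omega p.1 q.1) / W.
have lE : `|l| <= (2 + N * K) * E.
  rewrite normrM normfV (gtr0_norm W0) ler_pdivrMr//.
  apply: (@le_trans _ _ ((2 + N * K) * E)); last first.
    by rewrite ler_peMr// mulr_ge0// addr_ge0// mulr_ge0.
  rewrite [leRHS]mulrDl; apply: le_trans (ler_normB _ _) _; apply: lerD.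
    by rewrite normrM ger0_norm// ler_pM2l.
  have -> : omega p.1 q.1 = omega p.1 (q.1 - p.1) by rewrite omegaDr omegaNr omegazz subr0.
  by rewrite -mulrA; apply: omega_bound => // i; rewrite !mxE.
pose w := q.1 - (l *: v0 + p.1).
have qE : q = hmul (hmul (l *: v0, 0) p) (w, 0).
  rewrite [LHS]surjective_pairing /hmul /=; congr pair; first by rewrite /w addrC subrK.
  have -> : omega (l *: v0 + p.1) w = l * omega v0 q.1 + omega p.1 q.1.
    by rewrite /w omegaDr omegaNr omegazz subr0 omegaDl omegaZl.
  have -> : omega (l *: v0) p.1 = l * omega v0 p.1 by rewrite omegaZl.
  have : l * W = 2 * (q.2 - p.2) - omega p.1 q.1 by rewrite divfK// gt_eqF.
  by rewrite /W omegaDr; lra.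
apply: (@le_trans _ _ (cc_dist (hmul (l *: v0, 0) p) q)).
  by apply: ereal_inf_lbound; exists (l *: v0) => //=; exact: memvZ.
rewrite {1}qE; apply: le_trans (cc_dist_horizontal_le _ _) _.
rewrite -EFinM lee_fin.
pose B := 1 + (2 + N * K) * L.
have B0 : 0 <= B by rewrite addr_ge0// mulr_ge0// addr_ge0// mulr_ge0.
have wB i : `|w 0 i| <= B * E.
  have -> : w 0 i = (q.1 0 i - p.1 0 i) - l * v0 0 i by rewrite !mxE; ring.
  apply: le_trans (ler_normB _ _) _; rewrite mulrDl mul1r; apply: lerD => //.
  by rewrite normrM mulrAC; exact: ler_pM.
apply: (@le_trans _ _ (N * (B * E))); last by rewrite -/B mulrA ler_wpM2r// lerDl.
rewrite -[leRHS]ger0_norm ?mulr_ge0// -sqrtr_sqr ler_wsqrtr//.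
apply: le_trans (dotr_bound wB) _.
by rewrite [leRHS]exprMn ler_wpM2r ?sqr_ge0// natr_sqr_le.
Qed.

Lemma hausdorff_dim_quot_le_euclid (A : set (heis R n)) p0 v0 : isotropic V ->
  v0 \in V -> omega v0 p0.1 != 0 -> exists2 e : R, 0 < e &
    forall r, 0 < r -> r <= e ->
    (hausdorff_dim (quot_dist V) (hprojR V @` (A `&` ball p0 r))
     <= hausdorff_dim euclid_dist (hprojR V @` A))%E.
Proof.
move=> isoV; wlog v01 : v0 / omega v0 p0.1 = 1 => [H v0V v00|v0V _].
  apply: (H ((omega v0 p0.1)^-1 *: v0)).
  - by rewrite omegaZl mulVf.
  - exact: memvZ.
  - by rewrite omegaZl mulVf// oner_neq0.
pose L := \sum_i `|v0 0 i|; pose S := \sum_i `|p0.1 0 i|.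
have L0 : 0 <= L by apply: sumr_ge0.
have S0 : 0 <= S by apply: sumr_ge0.
have N0 : 0 <= N by [].
have vL i : `|v0 0 i| <= L by rewrite /L (bigD1 i)//= lerDl sumr_ge0.
have pS i : `|p0.1 0 i| <= S by rewrite /S (bigD1 i)//= lerDl sumr_ge0.
pose K := N * (S + 1).
have K0 : 0 <= K by rewrite mulr_ge0// addr_ge0.
have NL0 : 0 <= N * L by rewrite mulr_ge0.
have Q0 : 0 < 2 * (N * L + 1) by rewrite mulr_gt0// ltr_wpDl.
have Q1 : 1 <= 2 * (N * L + 1) by lra.
exists (2 * (N * L + 1))^-1; first by rewrite invr_gt0.
move=> r r0 re; have rQ : r * (2 * (N * L + 1)) <= 1 by rewrite -ler_pdivlMr// mul1r.
have r1 : r <= 1 by apply: le_trans re _; rewrite invf_le1.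
have Hball (p : heis R n) : ball p0 r p -> forall i, `|p.1 0 i - p0.1 0 i| <= r.
  by move=> [[_ Hp] _] i; have /ltW := Hp 0 i; rewrite distrC.
have HK (p : heis R n) : ball p0 r p -> forall i, `|(hprojR V p).1 0 i| <= K.
  move=> /Hball Hp i; apply: coord_le => //.
  have [wV Hw] := orth_projP V p.1; set w := orth_proj V p.1 in wV Hw.
  have hE : (hprojR V p).1 = p.1 - w by rewrite /hprojR/= addrC.
  have : dotr p.1 p.1 = dotr (p.1 - w) (p.1 - w) + dotr w w.
    rewrite -{1 2}(subrK w p.1); have := Hw w wV; move: (p.1 - w) => a aw.
    by rewrite dotrDl !dotrDr (dotrC w a) aw addr0 add0r.
  have : dotr p.1 p.1 <= N * (S + 1) ^+ 2.
    apply: dotr_bound => j; rewrite -(subrK (p0.1 0 j) (p.1 0 j)).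
    apply: le_trans (ler_normD _ _) _; rewrite addrC; apply: lerD => //.
    exact: le_trans (Hp j) r1.
  have : N * (S + 1) ^+ 2 <= K ^+ 2 by rewrite exprMn ler_wpM2r ?sqr_ge0// natr_sqr_le.
  by have := dotr_ge0 w; rewrite hE; lra.
have Hom (p : heis R n) : ball p0 r p -> 1 / 2 <= omega v0 (hprojR V p).1.
  move=> /Hball Hp.
  have -> : omega v0 (hprojR V p).1 = 1 + omega v0 (p.1 - p0.1).
    rewrite /hprojR/= omegaDr omegaNr isoV// ?(orth_projP _ _).1// omegaDr omegaNr v01; ring.
  have /ler_normlP[+ _] : `|omega v0 (p.1 - p0.1)| <= N * (L * r).
    by apply: omega_bound => // i; rewrite !mxE.
  by move=> H; have := mulr_ge0 L0 (ltW r0); nra.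
have L10 : 0 <= (2 + N * K) * L by rewrite mulr_ge0// addr_ge0// mulr_ge0.
apply: le_hausdorff_dim => s s0 Hs.
apply: (@hausdorff_null_lipschitz _ _ euclid_dist (quot_dist V) s
  (N * (1 + (2 + N * K) * L) + 1)) => //.
- exact: euclid_dist_ge0.
- exact: quot_dist_ge0.
- by rewrite ltr_wpDl// mulr_ge0// addr_ge0.
- move=> p q /set_mem[p' [_ Bp'] <-] /set_mem[q' [_ Bq'] <-].
  apply: (@quot_le_euclid K L v0) => //; first exact: HK.
  by rewrite omegaDr; have := Hom _ Bp'; have := Hom _ Bq'; lra.
- by apply: sub_hausdorff_null Hs => p [p' [Ap' _] <-]; exists p'.
Qed.

End QuotientMetric.


Section UnitaryAction.
Context {R : realType} {n : nat}.
Implicit Types (z w : 'rV[R]_(n + n)) (c d : 'rV[R[i]]_n) (U : 'M[R[i]]_n).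
Local Open Scope sesquilinear_scope.

Lemma to_CK : cancel (@to_C R n) of_C.
Proof.
move=> z; apply/rowP => i; case: (split_ordP i) => j ->.
  by rewrite row_mxEl !mxE.
by rewrite row_mxEr !mxE.
Qed.

Lemma of_CK : cancel (@of_C R n) to_C.
Proof.
move=> c; apply/rowP => j; rewrite mxE /xcoord /ycoord row_mxEl row_mxEr !mxE.
by case: (c 0 j).
Qed.

Lemma to_C_linear (k : R) z w : to_C (k *: z + w) = (k%:C)%C *: to_C z + to_C w.
Proof.
apply/rowP => j; rewrite !mxE /xcoord /ycoord !mxE.
by apply/eqP; rewrite eq_complex /= !mul0r subr0 addr0 !eqxx.
Qed.

Lemma of_C_linear (k : R) c d : of_C ((k%:C)%C *: c + d) = k *: of_C c + of_C d.
Proof. by rewrite -{1}(of_CK c) -{1}(of_CK d) -to_C_linear to_CK. Qed.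

Fact unitary_act_is_linear U : linear (unitary_act U : 'rV[R]_(n + n) -> 'rV[R]_(n + n)).
Proof.
by move=> k z w; rewrite /unitary_act to_C_linear mulmxDl -scalemxAl of_C_linear.
Qed.

HB.instance Definition _ U := GRing.isLinear.Build R 'rV[R]_(n + n) 'rV[R]_(n + n) _
  (unitary_act U) (unitary_act_is_linear U).

(* The Hermitian product has real part [dotr] and imaginary part [- omega]. *)
Lemma to_C_herm z w : (to_C z *m (to_C w)^t*) 0 0 = (dotr z w -i* omega z w)%C.
Proof.
rewrite mxE; apply/eqP; rewrite eq_complex dotr_split /omega /= !raddf_sum.
apply/andP; split; apply/eqP; apply: eq_bigr => j _;
  rewrite !mxE /= /xcoord /ycoord; ring.
Qed.

Lemma unitary_act_herm U z w : U \is unitarymx ->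
  to_C (unitary_act U z) *m (to_C (unitary_act U w))^t* = to_C z *m (to_C w)^t*.
Proof.
rewrite -trmx_unitary => UU; rewrite /unitary_act !of_CK trmx_mul map_mxM mulmxA.
by rewrite mulmxtVK.
Qed.

Lemma omega_unitary_act U z w : U \is unitarymx ->
  omega (unitary_act U z) (unitary_act U w) = omega z w.
Proof.
move=> UU; have := to_C_herm z w; rewrite -(unitary_act_herm z w UU) to_C_herm.
by move=> /(congr1 (@complex.Im R)) /= /oppr_inj.
Qed.

Lemma unitary_actK U z : U \is unitarymx -> unitary_act (U^t*) (unitary_act U z) = z.
Proof.
move=> UU; rewrite /unitary_act of_CK -mulmxA -trmx_mul.
have -> : U^t* *m U = 1%:M by apply/mulmx1C/unitarymxP.
by rewrite trmx1 mulmx1 to_CK.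
Qed.

(* The complex Householder map [x |-> x - <x, u> / <z, u> u] with [u = z - w] is unitary
   because [2 Re <z, u> = <u, u>] when [z] and [w] have the same norm. *)
Lemma unitary_act_trans z w : dotr z z = dotr w w ->
  exists2 U, U \is unitarymx & unitary_act U z = w.
Proof.
move=> zw; pose u := to_C (z - w); pose t := dotr (z - w) (z - w).
have tE : t = 2 * dotr z (z - w).
  rewrite /t dotrBl [in RHS]dotrC [in RHS]dotrBl !(dotrC _ (z - w)) !dotrBl (dotrC w z) zw; ring.
have [t0|t0] := eqVneq t 0.
  have /eqP := dotr_eq0 t0; rewrite subr_eq0 => /eqP ->; exists 1%:M.
    by apply/unitarymxP; rewrite trmx1 map_mx1 mulmx1.
  by rewrite /unitary_act trmx1 mulmx1 to_CK.
pose k : R[i] := (dotr z (z - w) -i* omega z (z - w))%C.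
have cu : to_C z *m u^t* = k%:M.
  by apply/matrixP => i j; rewrite !ord1 to_C_herm mxE eqxx mulr1n.
have uu : u *m u^t* = (t%:C)%C%:M.
  by apply/matrixP => i j; rewrite !ord1 to_C_herm omegazz oppr0 mxE eqxx mulr1n.
have k0 : k != 0.
  apply: contra t0; rewrite eq_complex /= => /andP[/eqP k1 _].
  by rewrite tE k1 mulr0.
have kk0 : (k^*)%R != 0 by rewrite conjC_eq0.
have kkt : k + (k^*)%R = (t%:C)%C.
  by apply/eqP; rewrite eq_complex /= tE opprK addNr !eqxx andbT; apply/eqP; ring.
pose P := u^t* *m u; pose M := 1%:M - k^-1 *: P.
have PP : P *m P = (t%:C)%C *: P by rewrite /P mulmxA -(mulmxA _ u) uu mul_mx_scalar scalemxAl.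
have Pt : P^t* = P.
  rewrite /P trmx_mul map_mxM; congr (_ *m _).
  by move: (u) => v; apply/matrixP => i j; rewrite !mxE; exact: conjCK.
have Mt : M^t* = 1%:M - (k^*)%R^-1 *: P.
  by rewrite /M linearB /= map_mxB trmx1 map_mx1 linearZ /= map_mxZ Pt fmorphV.
exists M^T.
  rewrite trmx_unitary; apply/unitarymxP; rewrite Mt /M mulmxBl mul1mx mulmxBr mulmx1.
  rewrite -scalemxAl -scalemxAr PP !scalerA -addrA -opprD -[RHS]subr0; congr (_ - _).
  rewrite -scalerBl -scalerDl -kkt -[RHS](scale0r P); congr (_ *: _).
  by field; rewrite k0 andbT; exact: kk0.
rewrite /unitary_act trmxK /M mulmxBr mulmx1 -scalemxAr mulmxA cu mul_scalar_mx scalerA.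
rewrite mulVf// scale1r; apply: (can_inj to_CK); rewrite of_CK /u.
have := to_C_linear (-1) w z; rewrite scaleN1r addrC => ->.
have -> : ((-1)%:C)%C = -1 :> R[i] by apply/eqP; rewrite eq_complex /= oppr0 !eqxx.
by rewrite scaleN1r opprD opprK addrCA subrr addr0.
Qed.
End UnitaryAction.

Section OmegaAnnihilator.
Context {R : realType} {n m : nat} {h : (m <= n)%N}.
Implicit Types (V W : Gh R h) (v w z : 'rV[R]_(n + n)).

Lemma Gh_dim V : \dim (Gh_val V) = m.
Proof. by case/andP: (valP V) => /eqP. Qed.

Lemma Gh_isotropic V : isotropic (Gh_val V).
Proof. by case/andP: (valP V) => _ /asboolP. Qed.

Definition annihilated w : set (Gh R h) := [set V | forall v, v \in Gh_val V -> omega v w = 0].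

Lemma annihilatedE w :
  annihilated w = \bigcap_i (@Gh_mx R n m h @^-1` [set M | omega (row i M) w = 0]).
Proof.
apply/seteqP; split => [V HV i _|V HV v vV].
  apply: HV; rewrite (_ : row i _ = orth_proj (Gh_val V) (delta_mx 0 i)).
    exact: (orth_projP _ _).1.
  by apply/rowP => j; rewrite !mxE.
rewrite (orth_proj_id vV); elim/big_ind : _ => [|x y Hx Hy|i _].
- by rewrite -(scale0r 0) omegaZl mul0r.
- by rewrite omegaDl Hx Hy addr0.
- rewrite omegaZl (_ : orth_proj _ _ = row i (Gh_mx V)); last first.
    by apply/rowP => j; rewrite !mxE.
  by rewrite (HV i) ?mulr0.
Qed.

Lemma continuous_omega_row w i : continuous (fun M : 'M[R]_(n + n) => omega (row i M) w).
Proof.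
move=> M; rewrite /omega /xcoord /ycoord; apply: cvg_big => [||j _];
  [exact: add_continuous|exact: (nbhs_filter M)|].
rewrite [X in X @ _ --> _](_ : _ = (fun M : 'M[R]_(n + n) => M i (lshift n j) * w 0 (rshift n j)
   - M i (rshift n j) * w 0 (lshift n j))); last by apply/funext => N; rewrite !mxE.
have H k l (c : R) : (fun N : 'M[R]_(n + n) => N k l * c) @ M --> M k l * c.
  apply: cvgM; [exact: (nbhs_filter M)|exact: coord_continuous|].
  exact: (@cvg_cst _ _ _ _ (nbhs_filter M)).
by rewrite !mxE; apply: cvgB; [exact: (nbhs_filter M)|exact: H|exact: H].
Qed.

Lemma closed_annihilated w : closed (annihilated w).
Proof.
rewrite annihilatedE; apply: closed_bigI => i _.
apply: preimage_closed; first by move=> V _; exact: initial_continuous.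
apply: (@preimage_closed _ _ (fun M : 'M[R]_(n + n) => omega (row i M) w) [set x | x = 0]).
  by move=> M _; exact: continuous_omega_row.
exact: closed_eq.
Qed.

Lemma borel_annihilated w : borel_set (annihilated w).
Proof.
rewrite -[annihilated w]setCK.
have : measurable (~` annihilated w : set (borel (Gh R h))).
  by apply: sub_sigma_algebra; apply: closed_openC; exact: closed_annihilated.
exact: measurableC.
Qed.

Lemma Gh_act_annihilated (U : 'M[R[i]]_n) w : U \is unitarymx ->
  Gh_act U (annihilated w) = annihilated (unitary_act U w).
Proof.
move=> UU; apply/seteqP; split => [W [V HV WV] v vW|W HW].
  have : [set` Gh_val W] v by [].
  by rewrite WV => -[u /= uV <-]; rewrite omega_unitary_act// HV.
have UU' : (map_mx Num.conj U^T) \is unitarymx by rewrite trmxC_unitary.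
pose f := linfun (unitary_act (map_mx Num.conj U^T) : 'rV[R]_(n + n) -> 'rV[R]_(n + n)).
have fE v : f v = unitary_act (map_mx Num.conj U^T) v by rewrite lfunE.
have UK v : unitary_act U (f v) = v.
  rewrite fE; have := unitary_actK v UU'.
  suff -> : map_mx Num.conj (map_mx Num.conj U^T)^T = U by [].
  by apply/matrixP => i j; rewrite !mxE; exact: conjCK.
have VP : (\dim (f @: Gh_val W)%VS == m) && `[< isotropic (f @: Gh_val W)%VS >].
  apply/andP; split.
    rewrite limg_dim_eq ?Gh_dim//; suff /eqP -> : lker f == 0%VS by rewrite capv0.
    by apply/lker0P => x y /(congr1 (unitary_act U)); rewrite !UK.
  apply/asboolP => u v /memv_imgP[u' u'W ->] /memv_imgP[v' v'W ->].
  by rewrite !fE omega_unitary_act// (@Gh_isotropic W).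
exists (exist (fun V : {vspace 'rV[R]_(n + n)} => (\dim V == m) && `[< isotropic V >])
  _ VP : Gh R h).
  move=> _ /memv_imgP[v vW ->].
  by rewrite -(@omega_unitary_act _ _ U)// UK HW.
apply/seteqP; split => [v vW|_ [_ /memv_imgP[v vW ->] <-]]; last by rewrite UK.
by exists (f v); [exact: memv_img|exact: UK].
Qed.

Definition moment (x : R) : 'rV[R]_(n + n) := \row_i x ^+ i.

Definition omega_poly v : {poly R} :=
  rVpoly (row_mx (\row_j - ycoord v j) (\row_j xcoord v j)).

Lemma omega_poly_moment v x : (omega_poly v).[x] = omega v (moment x).
Proof.
rewrite /omega_poly /rVpoly horner_poly.
under eq_bigr do rewrite valK.
rewrite big_split_ord/= /omega -big_split; apply: eq_bigr => j _ /=.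
by rewrite row_mxEl row_mxEr /moment /xcoord /ycoord !mxE; ring.
Qed.

Lemma omega_poly_eq0 v : omega_poly v = 0 -> v = 0.
Proof.
move=> /(congr1 (poly_rV (d := n + n))); rewrite rVpolyK linear0 => /rowP H.
apply/rowP => i; rewrite mxE; case: (split_ordP i) => j ->.
  by have := H (rshift n j); rewrite row_mxEr !mxE.
by have := H (lshift n j); rewrite row_mxEl !mxE => /eqP; rewrite oppr_eq0 => /eqP.
Qed.

(* A nonzero [v] in [V] gives a nonzero polynomial of degree less than [2n] vanishing at
   every [k] whose moment vector is annihilated by [V]. *)
Lemma annihilated_moment_count (s : nat -> R) V (M : nat) : (0 < m)%N -> (forall k, s k != 0) ->
  \sum_(k < M) \1_(annihilated (s k *: moment k%:R)) V <= (n + n)%:R :> R.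
Proof.
move=> m0 s0; pose v := vpick (Gh_val V).
have vV : v \in Gh_val V by exact: memv_pick.
have v0 : v != 0.
  by rewrite vpick0 -dimv_eq0 Gh_dim -lt0n.
have p0 : omega_poly v != 0 by apply: contra v0 => /eqP/omega_poly_eq0 ->.
pose rs := [seq k%:R : R | k <- iota 0 M & V \in annihilated (s k *: moment k%:R)].
have rsr : all (root (omega_poly v)) rs.
  apply/allP => x /mapP[k + ->{x}]; rewrite mem_filter => /andP[/set_mem Vk _].
  rewrite rootE omega_poly_moment; have /eqP := Vk v vV.
  by rewrite omegaZr mulf_eq0 (negbTE (s0 k)).
have rsu : uniq rs.
  rewrite map_inj_uniq ?filter_uniq ?iota_uniq// => k l /eqP.
  by rewrite eqr_nat => /eqP.
have /ltnW := leq_trans (max_poly_roots p0 rsr rsu) (size_poly _ _).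
rewrite size_map size_filter -sum1_count big_mkcond/= => rsN.
under eq_bigr do rewrite indicE.
rewrite -natr_sum ler_nat; apply: leq_trans rsN.
rewrite -[M in iota 0 M]subn0 -/(index_iota 0 M) big_mkord.
by apply: leq_sum => k _; case: (_ \in _).
Qed.

Lemma annihilated_null (mu : probability (borel (Gh R h)) R) z : (0 < m)%N ->
  unitary_invariant mu -> z != 0 -> mu (annihilated z) = 0%E.
Proof.
move=> m0 muU z0.
have zz0 : 0 < dotr z z.
  rewrite lt_neqAle dotr_ge0 andbT eq_sym; apply: contra z0 => /eqP /dotr_eq0 ->; exact: eqxx.
have mm0 x : 0 < dotr (moment x) (moment x).
  rewrite lt_neqAle dotr_ge0 andbT eq_sym; apply/eqP => /dotr_eq0 /rowP.
  have N0 : (0 < n + n)%N by rewrite addn_gt0 (leq_trans m0 h).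
  by move=> /(_ (Ordinal N0)) /eqP; rewrite !mxE expr0 oner_eq0.
pose s (k : nat) := Num.sqrt (dotr z z / dotr (moment k%:R) (moment k%:R)).
have s0 k : s k != 0 by rewrite gt_eqF// sqrtr_gt0 divr_gt0.
pose S k := annihilated (s k *: moment k%:R).
have muS k : mu (S k) = mu (annihilated z).
  have [|U UU Uz] := @unitary_act_trans R n z (s k *: moment k%:R).
    by rewrite dotrZl dotrZr mulrA -expr2 sqr_sqrtr ?divfK ?gt_eqF// divr_ge0 ?dotr_ge0.
  by rewrite /S -Uz -Gh_act_annihilated// muU//; exact: borel_annihilated.
have mS w : measurable (annihilated w : set (borel (Gh R h))) by exact: borel_annihilated.
have fin : mu (annihilated z) \is a fin_num by exact: fin_num_measure.
have iS k : (\int[mu]_V (\1_(S k) V)%:E = mu (annihilated z))%E.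
  by rewrite integral_indic; [rewrite setIT; exact: muS|exact: measurableT|
    exact: (mS (s k *: moment k%:R))].
have bound (M : nat) : (M%:R * fine (mu (annihilated z)) <= (n + n)%:R)%R.
  rewrite -lee_fin EFinM fineK//.
  have -> : (M%:R%:E * mu (annihilated z) = \sum_(k < M) \int[mu]_V (\1_(S k) V)%:E)%E.
    under eq_bigr do rewrite iS.
    by rewrite sumr_const card_ord mule_natl.
  have mind k : measurable_fun setT (fun V : borel (Gh R h) => (\1_(S k) V)%:E : \bar R).
    by apply/measurable_EFinP/measurable_indic; exact: (mS (s k *: moment k%:R)).
  rewrite -ge0_integral_sum//.
  apply: (@le_trans _ _ (\int[mu]_(V in setT) (cst (n + n)%:R%:E V))%E).
    apply: ge0_le_integral => //=.
    - by move=> V _; apply: sume_ge0.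
    - exact: emeasurable_sum.
    - move=> V _; rewrite sumEFin lee_fin.
      exact: (@annihilated_moment_count s V M m0 s0).
  rewrite (@integral_cst _ _ _ mu _ measurableT) -[leRHS]mule1; apply: lee_wpmul2l => //.
  exact: (probability_le1 mu measurableT).
apply/eqP; rewrite eq_le measure_ge0 andbT -(fineK fin) lee_fin leNgt; apply/negP => c0.
have := bound (Num.truncn ((n + n)%:R / fine (mu (annihilated z)))).+1.
rewrite leNgt -ltr_pdivrMr//; move/negP; apply.
by apply: real_truncnS_gt; exact: num_real.
Qed.

End OmegaAnnihilator.

Theorem lemma3p3 (R : realType) (n m : nat) (hm1 : (1 <= m)%N) (hmn : (m <= n)%N)
    (mu : probability (borel (Gh R hmn)) R) (hmu : unitary_invariant mu)
    (alpha beta : R) (hbeta : 0 <= beta)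
    (halpha : 2 <= alpha) (halpha' : alpha < (2 * n + 2)%:R) :
  (forall A : set (heis R n), borel_set A ->
     (alpha%:E < hausdorff_dim cc_dist A)%E ->
     {ae mu, forall V : Gh R hmn,
       (beta%:E <= hausdorff_dim (quot_dist (Gh_val V))
                     (hprojR (Gh_val V) @` A))%E})
  <->
  (forall A : set (heis R n), borel_set A ->
     (alpha%:E < hausdorff_dim cc_dist A)%E ->
     {ae mu, forall V : Gh R hmn,
       (beta%:E <= hausdorff_dim euclid_dist (hprojR (Gh_val V) @` A))%E}).
Proof.
split=> H A bA dimA; last first.
  apply: filterS (H A bA dimA); first exact: (ae_filter_ringOfSetsType mu).
  by move=> V /le_trans; apply; exact: hausdorff_dim_euclid_le_quot.
have n0 : (0 < n)%N by exact: leq_trans hm1 hmn.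
have [p0 [p00 Hp0]] := cc_dim_concentration (Ordinal n0) halpha dimA.
have mA : measurable (A : set (borel (heis R n))) by [].
have Hk (k : nat) : {ae mu, forall V : Gh R hmn, (beta%:E <= hausdorff_dim
    (quot_dist (Gh_val V)) (hprojR (Gh_val V) @` (A `&` ball p0 k.+1%:R^-1)))%E}.
  apply: H; last by apply: Hp0; rewrite invr_gt0.
  apply: (measurableI (A : set (borel (heis R n)))) => //.
  by apply: sub_sigma_algebra; exact: ball_open.
have Hann : {ae mu, forall V : Gh R hmn, ~ annihilated p0.1 V}.
  exists (annihilated p0.1); split; first exact: borel_annihilated.
    exact: annihilated_null.
  by move=> V /= /contrapT.
apply: filterS2 (ae_foralln Hk) Hann => V HV nV.
have [v0 v0V v00] : exists2 v0, v0 \in Gh_val V & omega v0 p0.1 != 0.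
  apply: contrapT => nv; apply: nV => v vV; apply: contrapT => /eqP vp.
  by apply: nv; exists v.
have isoV := @Gh_isotropic R n m hmn V.
have [e e0 He] := hausdorff_dim_quot_le_euclid A isoV v0V v00.
pose k := Num.truncn e^-1.
apply: le_trans (HV k) (He _ _ _); first by rewrite invr_gt0.
rewrite -[leRHS]invrK lef_pV2 ?posrE ?invr_gt0//; apply: ltW.
by apply: real_truncnS_gt; exact: num_real.
Qed.
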